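(* Let $P,Q\in\mathbb{C}[X]$ be polynomials of degrees $n=\deg P\ge m=\deg Q\ge 2$. Write $$P'(X)=na_n\prod_{i=1}^{l}(X-\alpha_i)^{p_i},\qquad Q'(X)=mb_m\prod_{j=1}^{h}(X-\beta_j)^{q_j},$$ where $a_n,b_m$ are the leading coefficients, the $\alpha_i$ are pairwise distinct, the $\beta_j$ are pairwise distinct, and $p_i,q_j\ge 1$. Assume $P$ and $Q$ both satisfy Hypothesis I and that $P(x)-Q(y)$ has no factor of degree one. Let $A_0=\{(i,j): 1\le i\le l,\ 1\le j\le h,\ P(\alpha_i)=Q(\beta_j)\}$ and $A_1=\{(i,j)\in A_0: p_i>q_j\}$. If $$\sum_{(i,j)\in A_1}(p_i-q_j)\;+\;\sum_{\substack{1\le i\le l\\ (i,j)\notin A_0\text{ for all } j}} p_i\;\ge\; n-m+3,$$ then the projective plane curve $P(x)-Q(y)=0$ has no irreducible component of genus $0$ or $1$.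
   Context: A polynomial $P$ with $P'(X)=na_n\prod_{i=1}^l(X-\alpha_i)^{p_i}$ ($\alpha_i$ distinct) satisfies Hypothesis I if $P(\alpha_i)\ne P(\alpha_j)$ whenever $i\ne j$, i.e. $P$ is injective on the set of roots of $P'$; likewise for $Q$. The curve $P(x)-Q(y)=0$ is the projective closure in $\mathbb{P}^2(\mathbb{C})$ of the affine curve $\{P(x)=Q(y)\}$; genus means geometric genus. *)

(* Defs.v *)
(* Complex numbers are modelled as R[i] = complex R for an
   arbitrary R : realType (every realType is a complete archimedean ordered
   field, hence isomorphic to the reals, so R[i] is isomorphic to C). *)
From Stdlib Require List.
From HB Require Import structures.
From mathcomp Require Import all_boot all_algebra.
From mathcomp Require Export reals complex.
Set Implicit Arguments.
Unset Strict Implicit.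
Unset Printing Implicit Defensive.
Import GRing.Theory Num.Theory.
Local Open Scope ring_scope.

Section Curves.
Variable C : fieldType.

(* Bivariate polynomials C[x,y] are {poly {poly C}}: the OUTER variable is y,
   the inner variable (the coefficient ring {poly C}) is x. *)
Local Notation poly2 := {poly {poly C}}.

Definition Xvar : poly2 := ('X : {poly C})%:P.
Definition Yvar : poly2 := 'X.
Definition cst2 (c : C) : poly2 := c%:P%:P.

Definition curvePQ (P Q : {poly C}) : poly2 := P%:P - map_poly polyC Q.

Definition dvd2 (G A : poly2) : Prop := exists H : poly2, A = H * G.

Definition irreducible2 (G : poly2) : Prop :=
  [/\ G != 0, ~ (G \is a GRing.unit) &
      forall A B : poly2, G = A * B -> A \is a GRing.unit \/ B \is a GRing.unit].

Definition degree_one (G : poly2) : Prop :=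
  exists a b c : C, (a != 0 \/ b != 0) /\
    G = cst2 a * Xvar + cst2 b * Yvar + cst2 c.

(* Geometric genus of the irreducible component {G = 0} (G irreducible),  *)
(* defined through its function field K = Frac(C[x,y]/(G)), following    *)
(* Riemann / Chevalley: places of K/C are the normalized discrete         *)
(* valuations of K trivial on C.  Every element of K is A/B with A, B in  *)
(* C[x,y], G not dividing B, so a valuation of K is determined by its     *)
(* values on C[x,y]; we encode it as v : C[x,y] -> option int, where None *)
(* stands for +infinity (i.e. A = 0 in K, i.e. G | A).                    *)

Definition vle (x y : option int) : bool :=
  match x, y with
  | _, None => true
  | None, Some _ => false
  | Some a, Some b => (a <= b)%R
  end.

Definition vadd (x y : option int) : option int :=
  match x, y with
  | Some a, Some b => Some (a + b)%R
  | _, _ => None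
  end.

Definition vsub (x : option int) (k : nat) : option int :=
  match x with Some a => Some (a - k%:Z)%R | None => None end.

Definition is_place (G : poly2) (v : poly2 -> option int) : Prop :=
  [/\ forall A, v A = None <-> dvd2 G A,
      forall A B, v (A * B) = vadd (v A) (v B),
      forall A B, vle (v A) (v (A + B)) || vle (v B) (v (A + B)),
      forall c : C, c != 0 -> v (cst2 c) = Some 0%R
    & exists A B a b, [/\ v A = Some a, v B = Some b & (a - b = 1)%R]].

Definition eff_divisor (G : poly2) (D : seq ((poly2 -> option int) * nat)) :
  Prop :=
  (forall w k, List.In (w, k) D -> is_place G w) /\ List.NoDup (map fst D).

Definition deg_div (D : seq ((poly2 -> option int) * nat)) : nat :=
  sumn (map snd D).

(* The element A/B of K lies in the Riemann-Roch space L(D),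
   i.e. v_w(A/B) >= - D(w) for every place w. *)
Definition in_RR (G : poly2) (D : seq ((poly2 -> option int) * nat))
  (A B : poly2) : Prop :=
  forall w, is_place G w ->
    (forall k, List.In (w, k) D -> vle (vsub (w B) k) (w A)) /\
    (~ List.In w (map fst D) -> vle (w B) (w A)).

(* dim_C L(D) >= k : there are k elements A_i/B of L(D) (common denominator
   B, which is nonzero in K) that are C-linearly independent in K. *)
Definition ell_ge (G : poly2) (D : seq ((poly2 -> option int) * nat))
  (k : nat) : Prop :=
  exists (B : poly2) (A : 'I_k -> poly2),
    [/\ ~ dvd2 G B,
        forall i, in_RR G D (A i) B &
        forall c : 'I_k -> C, dvd2 G (\sum_(i < k) cst2 (c i) * A i) ->
          forall i, c i = 0].

(* Riemann's inequality l(D) >= deg D + 1 - g for all effective D. *)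
Definition genus_bound (G : poly2) (g : nat) : Prop :=
  forall D, eff_divisor G D -> ell_ge G D (deg_div D + 1 - g).

Definition geom_genus (G : poly2) (g : nat) : Prop :=
  genus_bound G g /\ forall g', genus_bound G g' -> (g <= g')%N.

End Curves.

(* Main.v *)
(* Let K be the function field of the component, d = [K : C(x)], and
   eta = N(x,y) dx / Q'(y) where N(x,y) is the product, over the pairs of critical points
   with P(alpha_i) = Q(beta_j), of (x - alpha_i)^p_i if p_i <= q_j and (y - beta_j)^q_j
   otherwise.  In terms of Puiseux expansions, eta is regular at finite distance; the
   numerical hypothesis says deg N(x,y) <= m - 4, so that eta and x eta are both regular at
   infinity.  Two independent regular differentials contradict Riemann's inequality for
   genus at most 1: take D to be the sum of two generic fibres of x, over a and a', so that
   deg D = 2d.  For f in L(D) the traces of f (x - a') eta and f (x - a) eta to C(x) have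
   at most a simple pole, at a resp. a', and vanish to order 2 at infinity, so they vanish.
   This gives two relations between the polar parts of f, and since a function without
   poles is constant, l(D) <= 2d - 2 + 1 < deg D. *)
Require Import Defs.
From HB Require Import structures.
From mathcomp Require Import all_boot all_order all_algebra all_field.
From mathcomp Require Import boolp reals complex generic_quotient.
From mathcomp Require Import ring zify.
Set Implicit Arguments.
Unset Strict Implicit.
Unset Printing Implicit Defensive.
Import Order.TTheory GRing.Theory Num.Theory.
Local Open Scope ring_scope.

(** * Power series and Hensel's lemma *)

(** Why two fibres: if f has poles over a only, the residues of f x eta are a times those of f eta,
    so both forms give the same relation and only l(D) <= deg D follows. With poles over a and a',
    the factors x - a' and x - a isolate one relation for each fibre. Genericity makes both fibres
    unramified and leaves eta without zeros on them, so each relation can be solved for any one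
    chosen polar coefficient. Neither differentials nor a Riemann surface is constructed: eta is
    handled as the function N / Q'(y). Over x = c + t^e the differential dx contributes t^(e-1), so
    regularity means order at least 1 - e. The exponent e need not be the ramification index of a
    place; it is taken so divisible that the whole fibre lies in one field of Laurent series. Norms
    and traces to C(x) then become products and sums over the fibre, and since a rational function
    of x has order divisible by e, the bound 1 - e improves to 0. Places occur only where membership
    in L(D) is used: they are restrictions of the Laurent order to the function field, divided by a
    generator of the value group. *)

Definition series (C : fieldType) : Type := nat -> C.

Section SeriesRing.
Variable C : fieldType.
Local Notation S := (series C).
Implicit Types (s u w : S) (n i k : nat).

HB.instance Definition _ := gen_eqMixin S.
HB.instance Definition _ := gen_choiceMixin S.

Definition ser0 : S := fun=> 0.
Definition ser_opp s : S := fun n => - s n.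
Definition ser_add s u : S := fun n => s n + u n.
Definition ser1 : S := fun n => (n == 0)%:R.
Definition ser_mul s u : S := fun n => \sum_(i < n.+1) s i * u (n - i)%N.

Lemma ser_addA : associative ser_add.
Proof. by move=> s u w; apply: funext => n; rewrite /ser_add addrA. Qed.
Lemma ser_addC : commutative ser_add.
Proof. by move=> s u; apply: funext => n; rewrite /ser_add addrC. Qed.
Lemma ser_add0 : left_id ser0 ser_add.
Proof. by move=> s; apply: funext => n; rewrite /ser_add add0r. Qed.
Lemma ser_addN : left_inverse ser0 ser_opp ser_add.
Proof. by move=> s; apply: funext => n; rewrite /ser_add addNr. Qed.

HB.instance Definition _ :=
  GRing.isZmodule.Build S ser_addA ser_addC ser_add0 ser_addN.

Definition trunc n s : {poly C} := \poly_(i < n.+1) s i.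

(** Coefficient [n] of a product sees only coefficients up to [n], so the ring laws for series can
    be read off from those of polynomials through [trunc]. *)
Lemma coef_mul_agree n (p p' q q' : {poly C}) :
  (forall i, (i <= n)%N -> p`_i = p'`_i) ->
  (forall i, (i <= n)%N -> q`_i = q'`_i) -> (p * q)`_n = (p' * q')`_n.
Proof.
move=> hp hq; rewrite !coefM; apply: eq_bigr => i _.
by rewrite hp ?hq ?leq_subr // -ltnS.
Qed.

Lemma coef_trunc n s i : (i <= n)%N -> (trunc n s)`_i = s i.
Proof. by move=> hi; rewrite coef_poly ltnS hi. Qed.

Lemma ser_mulE n k s u :
  (k <= n)%N -> ser_mul s u k = (trunc n s * trunc n u)`_k.
Proof.
move=> kn; rewrite coefM; apply: eq_bigr => i _.
have ik : (i <= k)%N by rewrite -ltnS.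
by rewrite !coef_trunc ?(leq_trans ik) // (leq_trans (leq_subr _ _)).
Qed.

Lemma ser_mulA : associative ser_mul.
Proof.
move=> s u w; apply: funext => n.
rewrite !(@ser_mulE n) //.
transitivity ((trunc n s * (trunc n u * trunc n w))`_n).
  apply: coef_mul_agree => // i hi; rewrite coef_trunc //.
  by rewrite (@ser_mulE n).
rewrite mulrA; apply: coef_mul_agree => // i hi; rewrite coef_trunc //.
by rewrite (@ser_mulE n).
Qed.

Lemma ser_mulC : commutative ser_mul.
Proof. by move=> s u; apply: funext => n; rewrite !(@ser_mulE n) // mulrC. Qed.

Lemma ser_mul1 : left_id ser1 ser_mul.
Proof.
move=> s; apply: funext => n.
by rewrite /ser_mul big_ord_recl subn0 mul1r big1 ?addr0 // => i _; rewrite mul0r.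
Qed.

Lemma ser_mulD : left_distributive ser_mul ser_add.
Proof.
move=> s u w; apply: funext => n; rewrite /ser_mul /ser_add -big_split /=.
by apply: eq_bigr => i _; rewrite mulrDl.
Qed.

Lemma ser1_neq0 : ser1 != ser0.
Proof. by apply/eqP => /(congr1 (fun f => f 0%N)) /eqP; rewrite oner_eq0. Qed.

HB.instance Definition _ :=
  GRing.Zmodule_isComNzRing.Build S ser_mulA ser_mulC ser_mul1 ser_mulD ser1_neq0.

Definition ser_unit : pred S := fun s => `[< exists u : S, u * s = 1 >].
Definition ser_inv s : S :=
  if pselect (exists u : S, u * s = 1) is left H then projT1 (cid H) else s.

Lemma ser_mulV : {in ser_unit, left_inverse 1 ser_inv *%R}.
Proof.
move=> s /asboolP hs; rewrite /ser_inv; case: pselect => // h.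
by case: (cid h).
Qed.
Lemma ser_unitPl s u : u * s = 1 -> ser_unit s.
Proof. by move=> h; apply/asboolP; exists u. Qed.
Lemma ser_inv_out : {in [predC ser_unit], ser_inv =1 id}.
Proof.
move=> s; rewrite inE => /asboolP hs; rewrite /ser_inv.
by case: pselect.
Qed.

HB.instance Definition _ :=
  GRing.ComNzRing_hasMulInverse.Build S ser_mulV ser_unitPl ser_inv_out.

Definition serT : S := fun n => (n == 1)%:R.

Lemma ser_coefD s u n : (s + u) n = s n + u n. Proof. by []. Qed.
Lemma ser_coefM0 s u : (s * u) 0%N = s 0%N * u 0%N.
Proof. by rewrite [LHS]big_ord_recl big_ord0 addr0. Qed.

Lemma serTM0 s : (serT * s) 0%N = 0.
Proof. by rewrite ser_coefM0 mul0r. Qed.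

Lemma serTMS s n : (serT * s) n.+1 = s n.
Proof.
rewrite [LHS]big_ord_recl mul0r add0r big_ord_recl mul1r subSS subn0.
by rewrite big1 ?addr0 // => i _; rewrite mul0r.
Qed.

Lemma serTXM n s k : (serT ^+ n * s) k = if (k < n)%N then 0 else s (k - n)%N.
Proof.
elim: n k => [|n IH] k; first by rewrite expr0 mul1r subn0.
rewrite exprS -mulrA; case: k => [|k]; first by rewrite serTM0.
by rewrite serTMS IH ltnS subSS.
Qed.

Lemma ser_dvdT n s : (forall i, (i < n)%N -> s i = 0) ->
  s = serT ^+ n * (fun k => s (n + k)%N : C).
Proof.
move=> h; apply: funext => k; rewrite serTXM.
by case: ltnP => [/h|nk] //; rewrite subnKC.
Qed.

Lemma ser_factor s : s != 0 ->
  exists n u, u 0%N != 0 /\ s = serT ^+ n * u.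
Proof.
move=> s0; have ex : exists n, s n != 0.
  apply: contrapT => h; move/eqP: s0; apply; apply: funext => n.
  by apply/eqP/negPn/negP => hn; apply: h; exists n.
case: (ex_minnP ex) => n hn hmin.
exists n, (fun k => s (n + k)%N); rewrite addn0; split=> //.
apply: ser_dvdT => i hi; apply/eqP/negPn/negP => /hmin.
by rewrite leqNgt hi.
Qed.

Lemma ser_integral s u : s * u = 0 -> (s == 0) || (u == 0).
Proof.
move=> h; case: eqVneq => //= s0; case: eqVneq => // u0.
have [n [s' [hs' es]]] := ser_factor s0.
have [k [u' [hu' eu]]] := ser_factor u0.
move: h; rewrite es eu mulrACA -exprD => /(congr1 (fun f : S => f (n + k)%N)).
rewrite serTXM ltnn subnn ser_coefM0 => /eqP.
by rewrite mulf_eq0 (negPf hs') (negPf hu').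
Qed.

HB.instance Definition _ := GRing.ComUnitRing_isIntegral.Build S ser_integral.

Definition serC (c : C) : S := fun n => if n is 0 then c else 0.

Fact serC_zmod : zmod_morphism serC.
Proof. by move=> a b; apply: funext; case=> [|n] //=; rewrite /GRing.add /GRing.opp /= /ser_add /ser_opp /= ?subr0 ?oppr0 ?addr0. Qed.
Fact serC_monoid : monoid_morphism serC.
Proof.
split; first by apply: funext; case.
move=> a b; apply: funext; case=> [|n]; first by rewrite ser_coefM0.
rewrite [RHS]big_ord_recl subn0 /= mulr0 add0r big1 // => i _.
by rewrite mul0r.
Qed.
HB.instance Definition _ := GRing.isZmodMorphism.Build C S serC serC_zmod.
HB.instance Definition _ := GRing.isMonoidMorphism.Build C S serC serC_monoid.

Definition ser_c0 s : C := s 0%N.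
Fact ser_c0_zmod : zmod_morphism ser_c0. Proof. by []. Qed.
Fact ser_c0_monoid : monoid_morphism ser_c0.
Proof. by split=> // s u; rewrite /ser_c0 ser_coefM0. Qed.
HB.instance Definition _ := GRing.isZmodMorphism.Build S C ser_c0 ser_c0_zmod.
HB.instance Definition _ := GRing.isMonoidMorphism.Build S C ser_c0 ser_c0_monoid.

Lemma ser_c0C c : ser_c0 (serC c) = c. Proof. by []. Qed.
Lemma ser_c0T : ser_c0 serT = 0. Proof. by []. Qed.

Lemma ser_c0_eq0 s : ser_c0 s = 0 -> exists u, s = serT * u.
Proof.
move=> h; exists (fun k => s k.+1); rewrite -[serT]expr1.
by rewrite {1}(@ser_dvdT 1 s) // => -[].
Qed.

Lemma horner_addM (F : {poly S}) (a w : S) :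
  exists r : S, F.[a + w] = F.[a] + F^`().[a] * w + r * w ^+ 2.
Proof.
elim/poly_ind: F => [|F c [r IH]].
  by exists 0; rewrite deriv0 !horner0 !mul0r !addr0.
exists (F^`().[a] + r * (a + w)).
rewrite derivD derivM derivX derivC mulr1 addr0 !hornerD !hornerM !hornerX !hornerC IH.
ring.
Qed.

Lemma horner_modT (F : {poly S}) (a b : S) n :
  (exists u, a - b = serT ^+ n * u) ->
  exists u, F.[a] - F.[b] = serT ^+ n * u.
Proof.
case=> u hu; elim/poly_ind: F => [|F c [r IH]].
  by exists 0; rewrite !horner0 subr0 mulr0.
exists (r * a + F.[b] * u); rewrite !hornerE.
have -> : F.[a] = F.[b] + serT ^+ n * r by rewrite -IH addrC subrK.
have -> : a = b + serT ^+ n * u by rewrite -hu addrC subrK.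
ring.
Qed.

Lemma ser_c0_horner (F : {poly S}) s :
  ser_c0 F.[s] = (map_poly ser_c0 F).[ser_c0 s].
Proof. by rewrite horner_map. Qed.

Section Hensel.
Variables (F : {poly S}) (z0 : C).
Hypothesis F0 : root (map_poly ser_c0 F) z0.
Hypothesis F1 : (map_poly ser_c0 F)^`().[z0] != 0.
Let kap : C := (map_poly ser_c0 F)^`().[z0].

(* Newton's method with the derivative frozen at [z0]. *)
Fixpoint newton n : S :=
  if n is n'.+1 then newton n' - serC kap^-1 * F.[newton n'] else serC z0.

(** Up to a quadratic term, a step multiplies the error by [1 - F'(newton n) / kap], which is
    divisible by [serT]. One coefficient is gained per step, and no series has to be inverted. *)
Lemma newtonP n : ser_c0 (newton n) = z0 /\
  exists u, F.[newton n] = serT ^+ n.+1 * u.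
Proof.
elim: n => [|n [IH0 [u hu]]] /=.
  split=> //; rewrite expr1; apply: ser_c0_eq0.
  by rewrite ser_c0_horner ser_c0C (rootP F0).
split.
  by rewrite rmorphB rmorphM /= IH0 hu exprS -mulrA rmorphM /= ser_c0T mul0r mulr0 subr0.
have [r ->] := horner_addM F (newton n) (- (serC kap^-1 * F.[newton n])).
have [v hv] : exists v, 1 - F^`().[newton n] * serC kap^-1 = serT * v.
  apply: ser_c0_eq0; rewrite rmorphB rmorphM /= rmorph1 ser_c0_horner IH0 ser_c0C.
  by rewrite -deriv_map -/kap mulfV ?subrr.
exists (v * u + r * (serC kap^-1) ^+ 2 * u ^+ 2 * serT ^+ n).
have -> : F.[newton n] + F^`().[newton n] * - (serC kap^-1 * F.[newton n]) =
  F.[newton n] * (1 - F^`().[newton n] * serC kap^-1) by ring.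
rewrite hv hu !exprS; ring.
Qed.

Lemma newton_stab n k : newton (n + k)%N n = newton n n.
Proof.
elim: k => [|k IH]; first by rewrite addn0.
have [_ [u hu]] := newtonP (n + k).
rewrite addnS /= ser_coefD IH hu mulrCA.
suff : (serT ^+ (n + k).+1 * (serC kap^-1 * u)) n = 0.
  by rewrite /GRing.opp /= /ser_opp => ->; rewrite oppr0 addr0.
by rewrite serTXM ltnS leq_addr.
Qed.

Lemma hensel : exists2 z : S, root F z & ser_c0 z = z0.
Proof.
(* Coefficient [n] is frozen from step [n] on, so the diagonal is the limit of the iteration. *)
pose z : S := fun n => newton n n.
exists z; last by [].
apply/eqP; apply: funext => n.
have [u hu] : exists u, F.[z] - F.[newton n] = serT ^+ n.+1 * u.
  apply: horner_modT; exists (fun k => (z - newton n) (n.+1 + k)%N).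
  apply: ser_dvdT => i hi.
  have -> : newton n = newton (i + (n - i)) by rewrite subnKC // -ltnS.
  by rewrite /GRing.add /= /ser_add /GRing.opp /= /ser_opp newton_stab subrr.
have [_ [v hv]] := newtonP n.
have -> : F.[z] = serT ^+ n.+1 * (u + v).
  by rewrite mulrDr -hu -hv subrK.
by rewrite serTXM ltnSn.
Qed.
End Hensel.

(** The inverse is the Hensel root of [s *: 'X - 1], whose derivative reduces to the nonzero
    constant term of [s]. *)
Lemma ser_inv_exists s : s 0%N != 0 -> exists u, u * s = 1.
Proof.
move=> s0; have h : map_poly ser_c0 (s *: 'X - 1) = (ser_c0 s) *: 'X - 1.
  by rewrite rmorphB /= rmorph1 map_polyZ map_polyX.
have [||z /rootP hz _] := @hensel (s *: 'X - 1) (ser_c0 s)^-1.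
- by rewrite h; apply/rootP; rewrite !hornerE mulfV ?subrr.
- by rewrite h derivB derivC derivZ derivX subr0 alg_polyC hornerC.
by exists z; move: hz; rewrite !hornerE mulrC => /eqP; rewrite subr_eq0 => /eqP.
Qed.

End SeriesRing.

(** * Laurent series *)

Definition laurent (C : fieldType) : Type := {fraction series C}.
HB.instance Definition _ (C : fieldType) := GRing.Field.on (laurent C).

Section Laurent.
Variable C : fieldType.
Local Notation S := (series C).
Local Notation L := (laurent C).
Implicit Types (x y z : L) (n k : int).

Definition emb : S -> L := @FracField.tofrac S.
HB.instance Definition _ := GRing.RMorphism.on emb.
Definition lC (c : C) : L := emb (serC c).
HB.instance Definition _ := GRing.RMorphism.copy lC (emb \o @serC C).
Definition lT : L := emb (serT C).

Lemma emb_eq0 s : (emb s == 0) = (s == 0).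
Proof. exact: tofrac_eq0. Qed.

Lemma emb_inj : injective emb.
Proof. by move=> s u /eqP; rewrite -subr_eq0 -rmorphB emb_eq0 subr_eq0 => /eqP. Qed.

Lemma laurent_fracE x : exists a b : S, b != 0 /\ x = emb a / emb b.
Proof.
elim/quotW: x => x; exists (\n_x), (\d_x); have dx := denom_ratioP x; split=> //.
have d0 : emb (\d_x) != 0 by rewrite emb_eq0.
apply: (mulIf d0); rewrite divfK //.
suff : FracField.mul (\pi x)%qT (FracField.tofrac (\d_x)) = FracField.tofrac (\n_x) by [].
rewrite !piE; apply/eqmodP; rewrite /= FracField.equivfE.
by rewrite !numden_Ratio ?mulf_neq0 ?dx ?(oner_neq0 S) // !mulr1 mulrC.
Qed.

Lemma serT_neq0 : serT C != 0.
Proof. by apply/eqP => /(congr1 (fun f : S => f 1%N)) /eqP; rewrite oner_eq0. Qed.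

Lemma lT_neq0 : lT != 0.
Proof. by rewrite emb_eq0 serT_neq0. Qed.

Definition lead n x := exists u : S, u 0%N != 0 /\ x = lT ^ n * emb u.

Lemma lead_exists x : x != 0 -> exists n, lead n x.
Proof.
have [a [b [b0 ->]]] := laurent_fracE x.
rewrite mulf_eq0 invr_eq0 !emb_eq0 negb_or => /andP[a0 _].
have [i [u [u0 ->]]] := ser_factor a0; have [j [v [v0 ->]]] := ser_factor b0.
have [w hw] := ser_inv_exists v0.
have hw' : emb w * emb v = 1 by rewrite -rmorphM hw rmorph1.
have v0' : emb v != 0 by apply: contraTneq (oner_neq0 L) => h; rewrite -hw' h mulr0 eqxx.
exists (i%:Z - j%:Z), (u * w); split.
  have : w 0%N * v 0%N = 1 by rewrite -ser_coefM0 hw.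
  move=> h; rewrite ser_coefM0 mulf_neq0 //.
  by apply: contraTneq (oner_neq0 C) => h0; rewrite -h h0 mul0r eqxx.
rewrite !rmorphM !rmorphXn /= -/lT expfzDr ?lT_neq0 // -exprnN -exprnP.
have -> : emb w = (emb v)^-1 by apply: (mulIf v0'); rewrite hw' mulVf.
by rewrite invfM; ring.
Qed.

Lemma lead_ge n k x : lead n x -> (exists s, x = lT ^ k * emb s) -> k <= n.
Proof.
move=> [u [u0 ->]] [s hs]; rewrite leNgt; apply/negP => nk.
have hk : k = n + `|(k - n)%R|%N by lia.
have : emb u = emb (serT C ^+ `|(k - n)%R| * s).
  apply: (mulfI (expfz_neq0 n lT_neq0)); rewrite hs {1}hk.
  by rewrite expfzDr ?lT_neq0 // -mulrA -exprnP rmorphM rmorphXn.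
move/emb_inj => hu; move: u0; rewrite hu serTXM ifT ?eqxx //; lia.
Qed.

Definition lord x : int :=
  if pselect (exists n, lead n x) is left H then projT1 (cid H) else 0.

Lemma lordP x : x != 0 -> lead (lord x) x.
Proof.
move/lead_exists => h; rewrite /lord; case: pselect => // H.
by case: (cid H).
Qed.

Lemma lead_lord n x : lead n x -> x != 0 /\ lord x = n.
Proof.
move=> h; have x0 : x != 0.
  case: h => u [u0 ->]; rewrite mulf_neq0 ?expfz_neq0 ?lT_neq0 ?emb_eq0 //.
  by apply: contraNneq u0 => ->.
split=> //; have h' := lordP x0; apply/eqP; rewrite eq_le; apply/andP; split.
  by apply: (lead_ge h); case: h' => u [_ e]; exists u.
by apply: (lead_ge h'); case: h => u [_ e]; exists u.
Qed.

Definition lvge n x := (x == 0) || (n <= lord x).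

Lemma lvgeP n x : reflect (exists s, x = lT ^ n * emb s) (lvge n x).
Proof.
apply: (iffP idP).
  case/orP => [/eqP ->|]; first by exists 0; rewrite rmorph0 mulr0.
  case: (eqVneq x 0) => [-> _|x0 hn]; first by exists 0; rewrite rmorph0 mulr0.
  have [u [_ e]] := lordP x0; exists (serT C ^+ `|(lord x - n)%R|%N * u).
  rewrite {1}e rmorphM rmorphXn /= -/lT mulrA; congr (_ * _).
  by rewrite exprnP -expfzDr ?lT_neq0 //; congr (_ ^ _); lia.
move=> h; rewrite /lvge; case: eqVneq => //= x0.
exact: lead_ge (lordP x0) h.
Qed.

Lemma lvgeD n x y : lvge n x -> lvge n y -> lvge n (x + y).
Proof.
move=> /lvgeP[s ->] /lvgeP[u ->]; apply/lvgeP; exists (s + u).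
by rewrite rmorphD mulrDr.
Qed.

Lemma lord_lC c : lord (lC c) = 0.
Proof.
case: (eqVneq c 0) => [->|c0].
  rewrite rmorph0 /lord; case: pselect => // H; case: (cid H) => n /= h.
  by case: (lead_lord h); rewrite eqxx.
suff /lead_lord[] : lead 0 (lC c) by [].
by exists (serC c); rewrite expr0z mul1r.
Qed.

Lemma lord_lTz n : lord (lT ^ n) = n.
Proof.
suff /lead_lord[] : lead n (lT ^ n) by [].
by exists 1; rewrite rmorph1 mulr1 oner_eq0.
Qed.

Lemma lordM x y : x != 0 -> y != 0 -> lord (x * y) = lord x + lord y.
Proof.
move=> /lordP [u [u0 ex]] /lordP [v [v0 ey]].
suff /lead_lord[] : lead (lord x + lord y) (x * y) by [].
exists (u * v); rewrite ser_coefM0 mulf_neq0 //; split=> //.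
by rewrite {1}ex {1}ey rmorphM expfzDr ?lT_neq0 // mulrACA.
Qed.

Lemma lresidue x : lvge 0 x -> exists c, lvge 1 (x - lC c).
Proof.
case/lvgeP => s; rewrite expr0z mul1r => ->; exists (s 0%N).
rewrite -rmorphB; have [u ->] : exists u, s - serC (s 0%N) = serT C * u.
  by apply: ser_c0_eq0; rewrite rmorphB /= ser_c0C /ser_c0 subrr.
by apply/lvgeP; exists u; rewrite rmorphM expr1z.
Qed.

End Laurent.
Arguments lT {C}.

(** The global argument uses only these properties; series themselves reappear only where fibres are
    split. [ord_residue] says that the residue field consists of constants. As [ord 0] carries no
    meaning, inequalities come with the alternative [x == 0]. *)
Record valuation (C L : fieldType) (f : {rmorphism C -> L}) := Valuation {
  ord : L -> int;
  unif : L;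
  unif_neq0 : unif != 0;
  ord_unif : ord unif = 1;
  ordM : forall x y, x != 0 -> y != 0 -> ord (x * y) = ord x + ord y;
  ord_const : forall c, ord (f c) = 0;
  ord_add : forall n x y, (x == 0) || (n <= ord x) -> (y == 0) || (n <= ord y) ->
    (x + y == 0) || (n <= ord (x + y));
  ord_residue : forall x, (x == 0) || (0 <= ord x) ->
    exists c, (x - f c == 0) || (1 <= ord (x - f c))
}.

Lemma lord_lT (C : fieldType) : lord (@lT C) = 1.
Proof. by rewrite -(lord_lTz C 1) expr1z. Qed.

Definition laurent_valuation (C : fieldType) : valuation (@lC C) :=
  Valuation (@lT_neq0 C) (@lord_lT C) (@lordM C) (@lord_lC C) (@lvgeD C) (@lresidue C).

(** * Valued fields *)

Section Valuation.
Variables (C L : fieldType) (f : {rmorphism C -> L}) (v : valuation f).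
Local Notation ord := (ord v).
Implicit Types (x y z : L) (n k : int).

(* [ord 0] is a junk value: zero is treated as an element of infinite order. *)
Definition vge n x := (x == 0) || (n <= ord x).

Lemma vge0 n : vge n 0. Proof. by rewrite /vge eqxx. Qed.

Lemma ord_vge n x : n <= ord x -> vge n x.
Proof. by rewrite /vge => ->; rewrite orbT. Qed.

Lemma vgePn n x : ~~ vge n x = (x != 0) && (ord x < n).
Proof. by rewrite /vge negb_or -ltNge. Qed.

Lemma vge_ord x : vge (ord x) x. Proof. by rewrite /vge lexx orbT. Qed.

Lemma vgeE n x : x != 0 -> vge n x = (n <= ord x).
Proof. by rewrite /vge => /negPf ->. Qed.

Lemma vge_le k n x : k <= n -> vge n x -> vge k x.
Proof. by rewrite /vge => kn; case: eqP => //= _; apply: le_trans. Qed.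

Lemma vgeD n x y : vge n x -> vge n y -> vge n (x + y).
Proof. exact: ord_add. Qed.

Lemma vge_lC c : vge 0 (f c).
Proof. by rewrite /vge ord_const lexx orbT. Qed.

Lemma vgeM n k x y : vge n x -> vge k y -> vge (n + k) (x * y).
Proof.
rewrite /vge mulf_eq0; case: (eqVneq x 0) => //= x0 hx.
by case: (eqVneq y 0) => //= y0 hy; rewrite ordM // lerD.
Qed.

Lemma vgeNW n x : vge n x -> vge n (- x).
Proof.
by move=> hx; rewrite -mulN1r -[n]add0r -(rmorphN1 f); apply: vgeM (vge_lC _) hx.
Qed.

Lemma vgeN n x : vge n (- x) = vge n x.
Proof. by apply/idP/idP => /vgeNW //; rewrite opprK. Qed.

Lemma vgeB n x y : vge n x -> vge n y -> vge n (x - y).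
Proof. by move=> hx hy; apply: vgeD; rewrite ?vgeN. Qed.

Lemma vge_sum n (I : Type) (r : seq I) (p : pred I) (F : I -> L) :
  (forall i, p i -> vge n (F i)) -> vge n (\sum_(i <- r | p i) F i).
Proof. by move=> h; apply: (big_ind (vge n)) => //; [exact: vge0 | exact: vgeD]. Qed.

Lemma vge1_lC c : vge 1 (f c) -> c = 0.
Proof. by rewrite /vge ord_const fmorph_eq0 orbF => /eqP. Qed.

Lemma ord_one : ord 1 = 0.
Proof. by rewrite -(rmorph1 f) ord_const. Qed.

Lemma ordV x : x != 0 -> ord x^-1 = - ord x.
Proof.
move=> x0; have : ord (x * x^-1) = 0 by rewrite mulfV // ord_one.
rewrite ordM ?invr_eq0 // => /eqP; rewrite addrC addr_eq0 => /eqP ->.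
by [].
Qed.

Lemma ordX x i : x != 0 -> ord (x ^+ i) = ord x *+ i.
Proof.
move=> x0; elim: i => [|i IH]; first by rewrite ord_one.
by rewrite exprS ordM ?expf_neq0 // IH mulrS.
Qed.

Lemma ord_prod (I : Type) (r : seq I) (p : pred I) (F : I -> L) :
  (forall i, p i -> F i != 0) ->
  ord (\prod_(i <- r | p i) F i) = \sum_(i <- r | p i) ord (F i).
Proof.
move=> h; elim: r => [|i r IH]; first by rewrite !big_nil ord_one.
rewrite !big_cons; case: ifP => // pi; rewrite ordM ?IH ?h //.
by elim/big_rec: _ => [|j y pj hy]; rewrite ?oner_neq0 // mulf_neq0 ?h.
Qed.

Lemma ord_add_dom x y : x != 0 -> vge (ord x + 1) y ->
  x + y != 0 /\ ord (x + y) = ord x.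
Proof.
move=> x0 hy.
have h : ~~ vge (ord x + 1) (x + y).
  apply/negP => hxy; have := vgeB hxy hy; rewrite addrK vgeE //; lia.
have xy0 : x + y != 0 by apply: contraNneq h => ->; exact: vge0.
split=> //; apply/eqP; rewrite eq_le; apply/andP; split.
  by move: h; rewrite vgeE //; lia.
by rewrite -vgeE //; apply: vgeD (vge_ord x) (vge_le _ hy); lia.
Qed.

Lemma ord_unit x c : c != 0 -> vge 1 (x - f c) -> x != 0 /\ ord x = 0.
Proof.
move=> c0 h; have := @ord_add_dom (f c) (x - f c).
by rewrite ord_const add0r [f c + _]addrC subrK fmorph_eq0; apply.
Qed.

Lemma vge_horner (p : {poly C}) x : vge 0 x -> vge 0 (map_poly f p).[x].
Proof.
move=> hx; elim/poly_ind: p => [|p c IH]; first by rewrite rmorph0 horner0 vge0.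
rewrite rmorphD rmorphM /= map_polyX map_polyC hornerD hornerM hornerX hornerC.
by apply: vgeD; [apply: (@vgeM 0 0) | exact: vge_lC].
Qed.

Lemma vge1_horner (p : {poly C}) x c : vge 1 (x - f c) ->
  vge 1 ((map_poly f p).[x] - f p.[c]).
Proof.
move=> hx; have hx0 : vge 0 x.
  rewrite -(subrK (f c) x); apply: vgeD (vge_lC c).
  by apply: vge_le hx.
have /factor_theorem [q hq] : root (p - p.[c]%:P) c.
  by rewrite /root !hornerE subrr.
have -> : (map_poly f p).[x] - f p.[c] = (map_poly f q).[x] * (x - f c).
  transitivity (map_poly f (p - p.[c]%:P)).[x].
    by rewrite rmorphB /= map_polyC hornerD hornerN hornerC.
  rewrite hq rmorphM /= rmorphB /= map_polyX map_polyC.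
  by rewrite hornerM hornerD hornerN hornerX hornerC.
by rewrite -[1]add0r; apply: vgeM hx; apply: vge_horner.
Qed.

End Valuation.

(** * Puiseux expansions of the solutions of Q(y) = P(x) *)

Section Split.
Variable C : numClosedFieldType.
Local Notation S := (series C).
Local Notation L := (laurent C).
Local Notation T := (serT C).

Lemma binomial_roots (a g : C) n : a != 0 -> g != 0 -> (0 < n)%N ->
  exists zs : seq C, [/\ size zs = n, uniq zs &
    forall z, z \in zs -> root (a *: 'X^n - g%:P) z /\ (a *: 'X^n - g%:P)^`().[z] != 0].
Proof.
move=> a0 g0 n0; set F := a *: 'X^n - g%:P.
have sF : size F = n.+1.
  by rewrite /F size_polyDl size_scale ?size_polyXn // size_polyN size_polyC g0.
have F0 : F != 0 by rewrite -size_poly_eq0 sF.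
have dF z : root F z -> F^`().[z] != 0.
  rewrite /root /F hornerD hornerN hornerZ hornerXn hornerC subr_eq0 => /eqP h.
  have z0 : z != 0.
    by apply: contraNneq g0 => z0; rewrite -h z0 expr0n eqn0Ngt n0 mulr0.
  rewrite derivB derivC subr0 derivZ derivXn hornerZ hornerMn hornerXn.
  by rewrite mulf_neq0 // mulrn_eq0 negb_or -lt0n n0 expf_neq0.
have [zs hzs] := closed_field_poly_normal F.
have l0 : lead_coef F != 0 by rewrite lead_coef_eq0.
have rzs z : z \in zs -> root F z.
  by move=> hz; rewrite hzs rootZ // root_prod_XsubC.
exists zs; split; last by move=> z hz; split; [exact: rzs | exact/dF/rzs].
  by move: sF; rewrite {1}hzs size_scale // size_prod_XsubC => -[].
rewrite -separable_prod_XsubC.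
have -> : \prod_(x <- zs) ('X - x%:P) = (lead_coef F)^-1 *: F.
  by rewrite {2}hzs scalerA mulVf // scale1r.
rewrite separable_poly.unlock derivZ coprimepZl ?invr_eq0 // coprimepZr ?invr_eq0 //.
by apply: Pdiv.ClosedField.root_coprimep => z /dF.
Qed.

(** After rescaling [y], the equation [Q(y) = P(x)] reduces modulo [serT] to a binomial, at finite
    distance as well as at infinity. In characteristic zero its roots are simple, so all of them
    lift. *)
Lemma hensel_binomial (F : {poly S}) (a g : C) n : a != 0 -> g != 0 -> (0 < n)%N ->
  map_poly (@ser_c0 C) F = a *: 'X^n - g%:P ->
  exists zs : seq S, [/\ size zs = n, uniq (map (@ser_c0 C) zs) & all (root F) zs].
Proof.
move=> a0 g0 n0 hF; have [zs [sz uz hz]] := binomial_roots a0 g0 n0.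
suff [ss ess rss] : exists2 ss, map (@ser_c0 C) ss = zs & all (root F) ss.
  by exists ss; split; rewrite ?ess // -sz -ess size_map.
have h z : z \in zs -> exists2 s, root F s & ser_c0 s = z.
  by move=> /hz[]; rewrite -hF; apply: hensel.
elim: zs h {hz uz sz} => [|z zs IH] /= h; first by exists [::].
have [|ss ess rss] := IH; first by move=> y hy; apply: h; rewrite inE hy orbT.
have [s rs es] := h z (mem_head _ _).
by exists (s :: ss); rewrite /= ?rs ?ess ?es.
Qed.

Lemma splits_by_roots (F : {poly L}) (ys : seq L) m : size F = m.+1 ->
  size ys = m -> uniq ys -> all (root F) ys ->
  F = lead_coef F *: \prod_(y <- ys) ('X - y%:P).
Proof.
by move=> sF sy uy ry; apply: all_roots_prod_XsubC; rewrite ?uniq_rootsE ?sF ?sy.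
Qed.

Lemma ser_c0_serC_poly (p : {poly C}) : map_poly (@ser_c0 C) (map_poly (@serC C) p) = p.
Proof. by apply/polyP => i; rewrite !coef_map. Qed.

Lemma mup_sub_root (p : {poly C}) a : (1 < size p)%N -> exists q,
  [/\ p - p.[a]%:P = q * ('X - a%:P) ^+ mup a (p - p.[a]%:P), q.[a] != 0 &
      (0 < mup a (p - p.[a]%:P))%N].
Proof.
move=> sp; set F := p - p.[a]%:P.
have F0 : F != 0.
  by rewrite subr_eq0; apply: contraTneq sp => ->; rewrite size_polyC; case: eqP.
have [n [q]] := multiplicity_XsubC F a; rewrite F0 /= => qa hF.
have -> : mup a F = n by rewrite hF mupMr // mup_XsubCX eqxx.
exists q; split=> //; rewrite lt0n; apply: contraNneq qa => n0.
by rewrite -[q]mulr1 -(expr0 ('X - a%:P)) -n0 -hF /root /F !hornerE subrr.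
Qed.

Section Fin.
Variables (P Q : {poly C}) (c : C) (e : nat).
Hypotheses (sP : (1 < size P)%N) (sQ : (1 < size Q)%N) (e0 : (0 < e)%N).
Let r := mup c (P - P.[c]%:P).
Let Qs := map_poly (@serC C) Q.
Let w : S := (map_poly (@serC C) P).[serC c + T ^+ e].

(** Write [P - P(c) = v (X - c)^r] and [Q - P(c) = u (X - b)^s]. The divisibility gives [k] with
    [k s = e r]; substituting [x = c + T^e], [y = b + T^k z] and cancelling [T^(e r)] leaves
    [z^s u(b + T^k z) = v(c + T^e)], which modulo [T] is the binomial [u(b) z^s = v(c)]. *)
Lemma local_roots b : Q.[b] = P.[c] -> (mup b (Q - P.[c]%:P) %| e * r)%N ->
  exists zs : seq S, [/\ size zs = mup b (Q - P.[c]%:P), uniq zs &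
     forall z, z \in zs -> ser_c0 z = b /\ Qs.[z] = w].
Proof.
move=> hb; have [v [hv v0 r0]] := mup_sub_root c sP; rewrite -/r in hv r0.
have [u [hu u0 s0]] := mup_sub_root b sQ; rewrite hb in hu s0.
set s := mup _ _ in hu s0 * => /dvdnP[k hk].
have k0 : (0 < k)%N by rewrite lt0n; apply: contraTneq e0 => k0; move: hk; rewrite k0 mul0n => /eqP; rewrite muln_eq0 [r == _]eqn0Ngt r0 orbF => /eqP->.
pose us := map_poly (@serC C) u; pose vs := map_poly (@serC C) v.
pose g : {poly S} := (serC b)%:P + T ^+ k *: 'X.
pose F : {poly S} := 'X^s * (us \Po g) - (vs.[serC c + T ^+ e])%:P.
have cT i : (0 < i)%N -> ser_c0 (T ^+ i) = 0.
  by move=> i0; rewrite rmorphXn /= ser_c0T expr0n eqn0Ngt i0.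
have hF : map_poly (@ser_c0 C) F = u.[b] *: 'X^s - (v.[c])%:P.
  rewrite rmorphB rmorphM /= map_polyXn map_comp_poly ser_c0_serC_poly.
  rewrite map_polyC /= ser_c0_horner ser_c0_serC_poly.
  rewrite rmorphD /= map_polyC /= ser_c0C map_polyZ /= cT // scale0r addr0.
  by rewrite comp_polyCr rmorphD /= ser_c0C cT // addr0 mulrC mul_polyC.
have [zs [sz uz rz]] := hensel_binomial u0 v0 s0 hF.
have Tk z z' : T ^+ k * z = T ^+ k * z' -> z = z'.
  by apply: mulfI; rewrite expf_neq0 // serT_neq0.
exists [seq serC b + T ^+ k * z | z <- zs]; split; first by rewrite size_map.
  by rewrite map_inj_uniq ?(map_uniq uz) // => z z' /addrI /Tk.
move=> _ /mapP[z hz ->]; split.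
  by rewrite rmorphD rmorphM /= cT // mul0r addr0.
move/(allP rz): hz => /rootP; rewrite /F hornerD hornerN hornerM hornerXn horner_comp.
rewrite /g hornerD hornerZ hornerX !hornerC => /eqP; rewrite subr_eq0 => /eqP hz.
have Qs_eq x : Qs.[x] = us.[x] * (x - serC b) ^+ s + serC P.[c].
  have eQ : Q = u * ('X - b%:P) ^+ s + P.[c]%:P by rewrite -hu subrK.
  rewrite /Qs [in LHS]eQ rmorphD rmorphM rmorphXn rmorphB /= map_polyX !map_polyC /=.
  by rewrite hornerD hornerM horner_exp hornerD hornerN hornerX !hornerC.
have Ps_eq x : (map_poly (@serC C) P).[x] = vs.[x] * (x - serC c) ^+ r + serC P.[c].
  have eP : P = v * ('X - c%:P) ^+ r + P.[c]%:P by rewrite -hv subrK.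
  rewrite [in LHS]eP rmorphD rmorphM rmorphXn rmorphB /= map_polyX !map_polyC /=.
  by rewrite hornerD hornerM horner_exp hornerD hornerN hornerX !hornerC.
rewrite Qs_eq /w Ps_eq -hz [serC b + _ - _]addrC addKr [serC c + _ - _]addrC addKr.
by rewrite exprMn -!exprM hk; congr (_ + _); rewrite mulrCA [RHS]mulrC [z ^+ s * _]mulrC.
Qed.

(** Local solutions above different roots [b] of [Q - P(c)] differ in their constant term, and those
    above one [b] are as many as its multiplicity. Together they number the degree of [Q], so they
    are all the roots. *)
Lemma split_fin : (forall b, Q.[b] = P.[c] -> (mup b (Q - P.[c]%:P) %| e * r)%N) ->
  exists ys : seq L, uniq ys /\
    map_poly (@lC C) Q - ((map_poly (@lC C) P).[lC c + lT ^+ e])%:P =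
      lC (lead_coef Q) *: \prod_(y <- ys) ('X - y%:P).
Proof.
move=> hdiv.
set F := Q - P.[c]%:P.
have sF : size F = size Q.
  by rewrite size_polyDl // size_polyN size_polyC; case: eqP => // _; apply: ltnW.
have F0 : F != 0 by rewrite -size_poly_gt0 sF ltnW.
have [rs hrs] := closed_field_poly_normal F.
have l0 : lead_coef F != 0 by rewrite lead_coef_eq0.
have rrs b : b \in rs -> Q.[b] = P.[c].
  move=> hb; apply/eqP; rewrite -subr_eq0.
  have : root F b by rewrite hrs rootZ // root_prod_XsubC.
  by rewrite /root /F !hornerE.
have /choice[zs hzs] b : exists zs : seq S, b \in rs -> [/\ size zs = mup b F, uniq zs &
     forall z, z \in zs -> ser_c0 z = b /\ Qs.[z] = w].
  case: (boolP (b \in rs)) => [hb|_]; last by exists [::].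
  by have [zs h] := local_roots (rrs b hb) (hdiv b (rrs b hb)); exists zs.
have mupF b : mup b F = count_mem b rs.
  by rewrite hrs -mul_polyC mupMr ?rootC // mu_prod_XsubC.
pose ss := [seq z | b <- undup rs, z <- zs b].
have inss z : z \in ss -> Qs.[z] = w.
  case/allpairsPdep => b [z' [hb hz ->]]; rewrite mem_undup in hb.
  by have [_ _ h] := hzs b hb; case: (h _ hz).
have uss : uniq ss.
  apply: allpairs_uniq_dep; first exact: undup_uniq.
    by move=> b; rewrite mem_undup => /hzs[].
  move=> _ _ /allpairsPdep[b [z [hb hz ->]]] /allpairsPdep[b' [z' [hb' hz' ->]]] /= ez.
  rewrite !mem_undup in hb hb'; have [_ _ h] := hzs b hb; have [_ _ h'] := hzs b' hb'.
  have [eb _] := h _ hz; have [eb' _] := h' _ hz'.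
  by move: hz' hz; rewrite -ez in eb' *; rewrite -eb -eb'.
have ssz : size ss = size rs.
  rewrite -(perm_size (perm_count_undup rs)) size_allpairs_dep size_flatten.
  congr sumn; rewrite /shape -map_comp; apply/eq_in_map => b; rewrite mem_undup => hb /=.
  by have [-> _ _] := hzs b hb; rewrite size_nseq mupF.
have srs : size Q = (size rs).+1 by rewrite -sF hrs size_scale // size_prod_XsubC.
have hw : (map_poly (@lC C) P).[lC c + lT ^+ e] = emb w.
  rewrite /w -horner_map rmorphD rmorphXn /= -map_poly_comp.
  by [].
have hQ x : (map_poly (@lC C) Q).[emb x] = emb Qs.[x].
  by rewrite /Qs -horner_map -map_poly_comp.
exists (map (@emb C) ss); split; first by rewrite (map_inj_uniq (@emb_inj C)).
set G := _ - _.
have szG : size G = size Q.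
  rewrite size_polyDl size_map_poly // size_polyN size_polyC.
  by case: eqP => // _; apply: ltnW.
have -> : lC (lead_coef Q) = lead_coef G.
  rewrite lead_coefDl ?lead_coef_map // size_polyN size_polyC size_map_poly.
  by case: eqP => // _; apply: ltnW.
apply: (@splits_by_roots _ _ (size rs)); rewrite ?szG ?size_map //.
  by rewrite (map_inj_uniq (@emb_inj C)).
by apply/allP => _ /mapP[z /inss hz ->]; rewrite /root hornerD hornerN hornerC hQ hz hw subrr.
Qed.

End Fin.

(** With [x = T^-m] and [y = T^-n z], both sides acquire the common factor [T^-(n m)]; what remains
    reduces modulo [T] to [lead_coef Q * z^m = lead_coef P]. *)
Lemma split_inf (P Q : {poly C}) n m : size P = n.+1 -> size Q = m.+1 ->
  (0 < n)%N -> (0 < m)%N ->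
  exists ys : seq L, uniq ys /\
    map_poly (@lC C) Q - ((map_poly (@lC C) P).[lT ^- m])%:P =
      lC (lead_coef Q) *: \prod_(y <- ys) ('X - y%:P).
Proof.
move=> sP sQ n0 m0.
have lP : lead_coef P != 0 by rewrite lead_coef_eq0 -size_poly_eq0 sP.
have lQ : lead_coef Q != 0 by rewrite lead_coef_eq0 -size_poly_eq0 sQ.
pose w : S := \sum_(i < n.+1) serC P`_i * T ^+ (m * (n - i)).
pose F : {poly S} := \poly_(j < m.+1) (serC Q`_j * T ^+ (n * (m - j))) - w%:P.
have cT i : ser_c0 (T ^+ i) = (i == 0%N)%:R.
  by rewrite rmorphXn /= ser_c0T expr0n.
have hw : ser_c0 w = lead_coef P.
  rewrite /w rmorph_sum /= big_ord_recr /= rmorphM /= cT subnn muln0 mulr1.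
  rewrite big1 ?add0r ?lead_coefE ?sP // => i _.
  by rewrite rmorphM /= cT muln_eq0 subn_eq0 eqn0Ngt m0 leqNgt ltn_ord mulr0.
have hF : map_poly (@ser_c0 C) F = lead_coef Q *: 'X^m - (lead_coef P)%:P.
  rewrite rmorphB /= map_polyC /= hw; congr (_ - _); apply/polyP => j.
  rewrite coef_map /= coef_poly coefZ coefXn ltnS.
  case: ltngtP => [jm|jm|->]; rewrite ?mulr0 ?rmorph0 //.
    by rewrite rmorphM /= cT muln_eq0 subn_eq0 eqn0Ngt n0 leqNgt jm mulr0.
  by rewrite rmorphM /= cT subnn muln0 mulr1 lead_coefE sQ mulr1.
have [zs [sz uz rz]] := hensel_binomial lQ lP m0 hF.
have T0 := lT_neq0 C.
have inj : injective (fun z : S => lT ^- n * emb z).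
  by move=> x y /(mulfI _) h; apply: emb_inj; apply: h; rewrite invr_eq0 expf_neq0.
exists [seq lT ^- n * emb z | z <- zs]; split.
  by rewrite map_inj_uniq ?(map_uniq uz).
set G := _ - _.
have szG : size G = m.+1.
  rewrite size_polyDl size_map_poly // size_polyN size_polyC sQ.
  by case: eqP.
have -> : lC (lead_coef Q) = lead_coef G.
  rewrite lead_coefDl ?lead_coef_map // size_polyN size_polyC size_map_poly sQ.
  by case: eqP.
apply: (@splits_by_roots _ _ m); rewrite ?szG ?size_map //.
  by rewrite map_inj_uniq ?(map_uniq uz).
apply/allP => _ /mapP[z /(allP rz) /rootP hz ->].
rewrite /root hornerD hornerN hornerC !horner_coef !size_map_poly sP sQ.
suff [-> ->] : \sum_(i < m.+1) (map_poly (@lC C) Q)`_i * (lT ^- n * emb z) ^+ i =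
     lT ^- (n * m) * emb (\poly_(j < m.+1) (serC Q`_j * T ^+ (n * (m - j)))).[z] /\
   \sum_(i < n.+1) (map_poly (@lC C) P)`_i * (lT ^- m) ^+ i = lT ^- (n * m) * emb w.
  by rewrite -mulrBr -rmorphB; move: hz; rewrite hornerD hornerN hornerC => ->; rewrite rmorph0 mulr0.
have hT a b i : (i <= b)%N -> (lT ^- a) ^+ i = lT ^- (a * b) * emb (T ^+ (a * (b - i))).
  move=> ib; rewrite rmorphXn /= exprVn -exprM mulnBr; apply: (mulIf (expf_neq0 (a * i) T0)).
  rewrite mulVf ?expf_neq0 // -mulrA -exprD subnK ?leq_mul // mulVf // expf_neq0 //.
split.
  rewrite horner_poly rmorph_sum mulr_sumr; apply: eq_bigr => i _.
  rewrite coef_map /= exprMn (hT n m) -1?ltnS // !rmorphM /= !rmorphXn /=.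
  by rewrite /lC -[lT ^- (n * m) * _ * _]mulrA [LHS]mulrCA !mulrA.
rewrite /w rmorph_sum mulr_sumr; apply: eq_bigr => i _.
rewrite coef_map /= (hT m n) -1?ltnS // !rmorphM /= mulnC.
by rewrite /lC [LHS]mulrCA.
Qed.

End Split.

(** * Function field: evaluation, norm and trace *)

Section Eval.
Variables (C L : fieldType) (f : {rmorphism C -> L}).
Implicit Types (X Y : L) (A B : {poly {poly C}}) (p : {poly C}).

Definition ev1 X : {poly C} -> L := horner_eval X \o map_poly f.
HB.instance Definition _ X := GRing.RMorphism.copy (ev1 X) (horner_eval X \o map_poly f).
Definition ev2 X Y : {poly {poly C}} -> L := horner_eval Y \o map_poly (ev1 X).
HB.instance Definition _ X Y :=
  GRing.RMorphism.copy (ev2 X Y) (horner_eval Y \o map_poly (ev1 X)).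

Lemma ev1E X p : ev1 X p = (map_poly f p).[X]. Proof. by []. Qed.
Lemma ev1C X c : ev1 X c%:P = f c.
Proof. by rewrite ev1E map_polyC hornerC. Qed.
Lemma ev1X X : ev1 X 'X = X.
Proof. by rewrite ev1E map_polyX hornerX. Qed.
Lemma ev2E X Y A : ev2 X Y A = (map_poly (ev1 X) A).[Y]. Proof. by []. Qed.
Lemma ev2C X Y p : ev2 X Y p%:P = ev1 X p.
Proof. by rewrite ev2E map_polyC hornerC. Qed.
Lemma ev2X X Y : ev2 X Y 'X = Y.
Proof. by rewrite ev2E map_polyX hornerX. Qed.
Lemma ev2_cst X Y c : ev2 X Y (cst2 c) = f c.
Proof. by rewrite ev2C ev1C. Qed.
Lemma ev2_Xvar X Y : ev2 X Y (Xvar C) = X.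
Proof. by rewrite ev2C ev1X. Qed.
Lemma ev2_Xsub X Y c : ev2 X Y (Xvar C - cst2 c) = X - f c.
Proof. by rewrite (rmorphB (ev2 X Y)) /= ev2_cst ev2_Xvar. Qed.
Lemma ev2_Ysub X Y c : ev2 X Y (Yvar C - cst2 c) = Y - f c.
Proof. by rewrite (rmorphB (ev2 X Y)) /= ev2_cst ev2X. Qed.
Lemma ev2_Y X Y p : ev2 X Y (map_poly polyC p) = ev1 Y p.
Proof.
by rewrite ev2E -map_poly_comp ev1E; congr (_.[_]); apply: eq_map_poly => c /=; rewrite ev1C.
Qed.
Lemma ev2_curve X Y P Q : ev2 X Y (curvePQ P Q) = ev1 X P - ev1 Y Q.
Proof. by rewrite rmorphB /= ev2C ev2_Y. Qed.

Lemma ev2_rmodp X Y G A : G \is monic -> ev2 X Y G = 0 ->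
  ev2 X Y (Pdiv.Ring.rmodp A G) = ev2 X Y A.
Proof.
move=> monG G0; rewrite {2}(Pdiv.RingMonic.rdivp_eq monG A) rmorphD rmorphM /=.
by rewrite G0 mulr0 add0r.
Qed.

End Eval.

(** * Gauss' lemma and generic points of a component *)

Section Gauss.
Variable C : closedFieldType.
Implicit Types (G U A : {poly {poly C}}) (k : {poly C}).

Lemma dvd_content U c : map_poly (horner_eval c) U = 0 ->
  exists2 U1, U = ('X - c%:P) *: U1 & size U1 = size U.
Proof.
move=> h; exists (\poly_(i < size U) (U`_i %/ ('X - c%:P))).
  apply/polyP => i; rewrite coefZ coef_poly; case: ltnP => hi; last first.
    by rewrite mulr0 nth_default.
  have : root U`_i c.
    by move/polyP/(_ i): h; rewrite coef_map coef0 /= /root => /eqP.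
  by rewrite root_factor_theorem => /divpK; rewrite mulrC => ->.
case: (eqVneq U 0) => [->|U0]; first by rewrite size_poly0 poly_def big_ord0 size_poly0.
apply: size_poly_eq; have : root (lead_coef U) c.
  by move/polyP/(_ (size U).-1): h; rewrite coef_map coef0 /= /root => /eqP.
rewrite -lead_coefE root_factor_theorem => /divpK hd.
by apply: contraNneq U0 => h0; rewrite -lead_coef_eq0 -hd h0 mul0r.
Qed.

(* Gauss' lemma: as C is algebraically closed, the content k can be removed one
   linear factor at a time. *)
Lemma gauss k G U A : k != 0 -> k *: G = U * A ->
  exists U' A', G = U' * A' /\ size A' = size A.
Proof.
move=> k0; have [n hn] := ubnP (size k).
elim: n k k0 hn U A => // n IH k k0 hn U A hG.
have [sk|/closed_rootP[c rc]] := boolP (size k == 1%N).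
  have [a a0 ka] := size_poly1P _ sk.
  exists ((a^-1)%:P *: U), A; split=> //.
  by rewrite -scalerAl -hG scalerA ka -polyCM mulVf // scale1r.
have /factor_theorem[k1 hk] := rc.
have k10 : k1 != 0 by apply: contraNneq k0 => h; rewrite hk h mul0r.
have XI (V V' : {poly {poly C}}) : ('X - c%:P) *: V = ('X - c%:P) *: V' -> V = V'.
  rewrite -!mul_polyC; apply: mulfI; by rewrite polyC_eq0 polyXsubC_eq0.
have sk : (size k1 < n)%N by move: hn; rewrite hk size_Mmonic ?monicXsubC // size_XsubC addn2 /=.
have /eqP : map_poly (horner_eval c) U * map_poly (horner_eval c) A = 0.
  rewrite -rmorphM -hG -mul_polyC rmorphM /= map_polyC /= horner_evalE.
  by rewrite (rootP rc) mul0r.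
rewrite mulf_eq0 => /orP[] /eqP /dvd_content[V hV sV].
  apply: (IH k1 k10 sk V A); apply: XI.
  by rewrite scalerA [_ * k1]mulrC -hk hG hV -scalerAl.
rewrite -sV; apply: (IH k1 k10 sk U V); apply: XI.
by rewrite scalerA [_ * k1]mulrC -hk hG hV -scalerAr.
Qed.

Variables (L : fieldType) (f : {rmorphism C -> L}) (X Y : L) (G : {poly {poly C}}).
Hypothesis irrG : irreducible2 G.
Hypothesis monG : G \is monic.
Hypothesis XT : forall p, p != 0 -> ev1 f X p != 0.
Hypothesis G0 : ev2 f X Y G = 0.

Lemma unit2_size1 U : U \is a GRing.unit -> size U = 1%N.
Proof. by rewrite poly_unitE => /andP[/eqP]. Qed.

(** Pseudo-divide [G] by a shorter [A]. A nonzero remainder also vanishes at the point and is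
    shorter still. A zero remainder factors [G] by [gauss], and irreducibility leaves only an [A]
    free of [y], which cannot vanish since [X] is transcendental. *)
Lemma ev2_min_size A : A != 0 -> ev2 f X Y A = 0 -> (size G <= size A)%N.
Proof.
have [n hn] := ubnP (size A); elim: n A hn => // n IH A hn A0 hA.
rewrite leqNgt; apply/negP => hlt.
have := Pdiv.Idomain.divp_eq G A; set k := _ ^+ _ => hk.
have k0 : k != 0 by rewrite expf_neq0 // lead_coef_eq0.
have [r0|r0] := eqVneq (G %% A) 0; last first.
  have := ltn_modp G A; rewrite A0 => hr.
  suff : (size G <= size (G %% A)%R)%N by move=> h; move: (ltn_trans (leq_ltn_trans h hr) hlt); rewrite ltnn.
  apply: IH => //; first exact: leq_trans hr _.
  have : ev2 f X Y (k *: G) = ev2 f X Y (G %/ A * A + G %% A) by rewrite hk.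
  by rewrite -mul_polyC !rmorphD !rmorphM /= G0 hA !mulr0 add0r => <-.
move: hk; rewrite r0 addr0 => /(gauss k0)[U' [A' [eG sA]]].
case: irrG => _ _ /(_ _ _ eG)[] /unit2_size1 h1.
  move: hlt; rewrite -sA eG; have -> : U' = (U'`_0)%:P by apply: size1_polyC; rewrite h1.
  rewrite mul_polyC size_scale ?ltnn //.
  apply/eqP => h; have : U' = 0 by rewrite (@size1_polyC _ U') ?h1 // h.
  by move=> U0; rewrite U0 size_poly0 in h1.
have A1 : A = (A`_0)%:P by apply: size1_polyC; rewrite -sA h1.
have : A`_0 != 0 by apply: contraNneq A0 => h; rewrite A1 h.
by move=> /XT; rewrite -(ev2C f X Y) -A1 hA eqxx.
Qed.

(** Thus a point of the component with transcendental [X] is generic, and evaluation at it embeds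
    the function field into [L]. *)
Lemma ev2_eq0 A : ev2 f X Y A = 0 <-> dvd2 G A.
Proof.
split=> [hA|[H ->]]; last by rewrite rmorphM /= G0 mulr0.
exists (Pdiv.Ring.rdivp A G).
rewrite {1}(Pdiv.RingMonic.rdivp_eq monG A).
have [->|r0] := eqVneq (Pdiv.Ring.rmodp A G) 0; first by rewrite addr0.
have := @ev2_min_size _ r0; rewrite ev2_rmodp // => /(_ hA).
by rewrite leqNgt Pdiv.Ring.ltn_rmodp monic_neq0.
Qed.

End Gauss.

(** * Norm and trace from the function field to C(x) *)

Section NormTrace.
Variables (C L : fieldType) (f : {rmorphism C -> L}) (G : {poly {poly C}}).
Hypothesis monG : G \is monic.
Local Notation N := (size G).-1.

(** The matrix of multiplication by [A] on [C[x][y]/(G)], in the basis of powers of [y]. *)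
Definition mulM (A : {poly {poly C}}) : 'M[{poly C}]_N :=
  \matrix_(i, j) (Pdiv.Ring.rmodp ('X^i * A) G)`_j.
Definition normP A := \det (mulM A).
(** The adjugate in place of the inverse keeps the entries polynomial: the trace of [U / D] is
    [traceP U D / normP D]. *)
Definition traceP U D := \tr (mulM U *m \adj (mulM D)).

Variables (X : L) (y : 'I_N -> L).
Hypotheses (y_inj : injective y) (y_root : forall k, ev2 f X (y k) G = 0).

Let W : 'M[L]_N := Vandermonde N (\row_k y k).

Lemma Vandermonde_unit : W \in unitmx.
Proof.
rewrite unitmxE det_Vandermonde unitfE.
apply/prodf_neq0 => i _; apply/prodf_neq0 => j ij; rewrite !mxE subr_eq0.
by apply: contraTneq ij => /y_inj ->; rewrite ltnn.
Qed.

Let evm (A : {poly {poly C}}) := map_mx (ev1 f X) (mulM A).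
Let dg (A : {poly {poly C}}) := diag_mx (\row_k ev2 f X (y k) A).

(** The remainder of [y^i A] modulo [G] takes the value [y_k^i A(y_k)] at a root [y_k] of [G]. Hence
    the Vandermonde columns diagonalise all multiplications at once, and norm and trace become a
    product and a sum over the fibre. *)
Lemma mulM_Vandermonde A : evm A *m W = W *m dg A.
Proof.
apply/matrixP => i k; rewrite mul_mx_diag !mxE.
under eq_bigr do rewrite !mxE.
have <- : ev2 f X (y k) (Pdiv.Ring.rmodp ('X^i * A) G) = y k ^+ i * ev2 f X (y k) A.
  by rewrite ev2_rmodp // rmorphM rmorphXn /= ev2X.
rewrite ev2E (@horner_coef_wide _ N).
  by apply: eq_bigr => j _; rewrite coef_map.
apply: leq_trans (size_poly _ _) _.
by rewrite -ltnS (leq_trans _ (leqSpred _)) // Pdiv.Ring.ltn_rmodp monic_neq0.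
Qed.

Lemma det_evm A : \det (evm A) = \prod_k ev2 f X (y k) A.
Proof.
have := congr1 determinant (mulM_Vandermonde A); rewrite !det_mulmx mulrC.
have := Vandermonde_unit; rewrite unitmxE unitfE => w0 /(mulfI w0) ->.
by rewrite det_diag; apply: eq_bigr => k _; rewrite mxE.
Qed.

Lemma normP_ev A : ev1 f X (normP A) = \prod_k ev2 f X (y k) A.
Proof. by rewrite /normP -det_map_mx det_evm. Qed.

Lemma traceP_ev U D : (forall k, ev2 f X (y k) D != 0) ->
  ev1 f X (traceP U D) =
  ev1 f X (normP D) * \sum_k (ev2 f X (y k) U / ev2 f X (y k) D).
Proof.
move=> D0; set d := ev1 f X (normP D).
pose E := diag_mx (\row_k (ev2 f X (y k) U / ev2 f X (y k) D)).
pose I := diag_mx (\row_k (ev2 f X (y k) D)^-1).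
have hI : dg D *m I = 1%:M.
  apply/matrixP => i j; rewrite mul_diag_mx !mxE.
  by case: eqP => [->|_]; rewrite ?mulr0 // mulfV.
have hE : dg U *m I = E by apply/matrixP => i j; rewrite mul_diag_mx !mxE mulrnAr.
have hadj : \adj (evm D) *m W = d *: (W *m I).
  rewrite -[W in LHS]mulmx1 -hI !mulmxA -[_ *m W *m _]mulmxA -mulM_Vandermonde mulmxA.
  by rewrite mul_adj_mx det_evm -normP_ev -/d mul_scalar_mx -scalemxAl.
have hM : evm U *m \adj (evm D) = W *m (d *: E) *m invmx W.
  rewrite -[LHS](mulmxK Vandermonde_unit) -[_ *m _ *m W]mulmxA hadj.
  by rewrite -!scalemxAr mulmxA mulM_Vandermonde -mulmxA hE.
rewrite /traceP -trace_map_mx map_mxM /= map_mx_adj -/(evm U) -/(evm D) hM.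
rewrite -mulmxA mxtrace_mulC -mulmxA mulVmx ?Vandermonde_unit // mulmx1.
by rewrite mxtraceZ mxtrace_diag; congr (_ * _); apply: eq_bigr => k _; rewrite mxE.
Qed.

End NormTrace.

(** * Orders and places *)

Section Orders.
Variables (C : numClosedFieldType) (L : fieldType) (f : {rmorphism C -> L}).
Variable v : valuation f.
Local Notation ord := (ord v).
Local Notation vge := (vge v).
Local Notation ev1 := (ev1 f).
Local Notation ev2 := (ev2 f).
Implicit Types (p : {poly C}) (x : L).

Lemma ev1_near x c p : x - f c != 0 -> 1 <= ord (x - f c) -> p != 0 ->
  ev1 x p != 0 /\ ord (ev1 x p) = ord (x - f c) *+ mup c p.
Proof.
move=> xc0 hx p0; have hx1 : vge 1 (x - f c) by rewrite vgeE.
have [n [q]] := multiplicity_XsubC p c; rewrite p0 /= => qc hp.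
have mp : mup c p = n by rewrite hp mupMr // mup_XsubCX eqxx.
have [q0 oq] := ord_unit qc (vge1_horner q hx1).
have eX : ev1 x ('X - c%:P) = x - f c by rewrite rmorphB /= ev1X ev1C.
have -> : ev1 x p = ev1 x q * (x - f c) ^+ n by rewrite {1}hp rmorphM rmorphXn /= eX.
rewrite mp -ev1E in q0 oq *.
by rewrite mulf_neq0 ?expf_neq0 // ordM ?expf_neq0 // ordX // oq add0r.
Qed.

Lemma ev1_far x p : x != 0 -> ord x < 0 -> p != 0 ->
  ev1 x p != 0 /\ ord (ev1 x p) = ord x *+ (size p).-1.
Proof.
move=> x0 hx; elim/poly_ind: p => [|p c IH]; first by rewrite eqxx.
rewrite rmorphD rmorphM /= ev1X ev1C size_MXaddC.
case: (eqVneq p 0) => [-> /=|p0 _].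
  case: (eqVneq c 0) => [->|c0 _]; first by rewrite mul0r polyC0 addr0 eqxx.
  by rewrite rmorph0 mul0r add0r fmorph_eq0 ord_const size_poly0 ?(negPf c0).
have [e0 eo] := IH p0.
have sp : size p = (size p).-1.+1 by rewrite -polySpred.
have [||h1 h2] := @ord_add_dom _ _ _ v (ev1 x p * x) (f c); first exact: mulf_neq0.
  apply: (vge_le (n := 0)); last exact: vge_lC.
  rewrite ordM // eo; set n := (size p).-1; have : ord x *+ n <= 0 by rewrite mulrn_wle0 // ltW.
  lia.
by split=> //=; rewrite h2 ordM // eo [in RHS]sp mulrSr.
Qed.

Lemma mup_deriv p b : (1 < size p)%N -> mup b p^`() = (mup b (p - p.[b]%:P)).-1.
Proof.
move=> sp; have [q [hq q0 s0]] := mup_sub_root b sp.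
set s := mup _ _ in hq s0 *; have es : s = s.-1.+1 by rewrite prednK.
have -> : p^`() = (q^`() * ('X - b%:P) + q *+ s) * ('X - b%:P) ^+ s.-1.
  have -> : p^`() = (p - p.[b]%:P)^`() by rewrite derivB derivC subr0.
  rewrite hq derivM deriv_exp derivXsubC mul1r.
  by rewrite mulrDl -[_ * _ * _]mulrA -exprS -es mulrnAl mulrnAr.
rewrite mupMr ?mup_XsubCX ?eqxx // /root !hornerE subrr mulr0 add0r hornerMn.
by rewrite mulrn_eq0 negb_or -lt0n s0.
Qed.

Lemma mup_lt_size p b : p != 0 -> (mup b p < size p)%N.
Proof.
move=> p0; have : ('X - b%:P) ^+ mup b p %| p by rewrite -mup_geq.
by move/(dvdp_leq p0); rewrite size_exp_XsubC.
Qed.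

Lemma dvdp_mup (d T : {poly C}) : d != 0 -> T != 0 ->
  (forall c, (mup c d <= mup c T)%N) -> d %| T.
Proof.
have [n hn] := ubnP (size d); elim: n d T hn => // n IH d T hn d0 T0 h.
have [sd|/closed_rootP[c rc]] := boolP (size d == 1%N).
  by have [a a0 ->] := size_poly1P _ sd; rewrite dvdpE -dvdpE -alg_polyC dvdpZl // dvd1p.
have /factor_theorem[d1 hd] := rc.
have rT : root T c by rewrite -dvdp_XsubCl XsubC_dvd // (leq_trans _ (h c)) // -XsubC_dvd // dvdp_XsubCl.
have /factor_theorem[T1 hT] := rT.
have d10 : d1 != 0 by apply: contraNneq d0 => e; rewrite hd e mul0r.
have T10 : T1 != 0 by apply: contraNneq T0 => e; rewrite hT e mul0r.
have X0 : ('X - c%:P : {poly C}) != 0 by rewrite polyXsubC_eq0.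
rewrite hd hT dvdp_mul2r //; apply: IH => //.
  by move: hn; rewrite hd size_Mmonic ?monicXsubC // size_XsubC addn2.
by move=> b; have := h b; rewrite hd hT !mupM // leq_add2r.
Qed.

Section Place.
Variables (G : {poly {poly C}}) (X Y : L).
Hypothesis kerG : forall A, ev2 X Y A = 0 <-> dvd2 G A.

(* [r] generates the value group of [ord] on the function field, which has index [r] in
   that of the Puiseux field when the expansion is ramified. *)
Definition place_fun (r : int) (A : {poly {poly C}}) : option int :=
  if ev2 X Y A == 0 then None else Some (ord (ev2 X Y A) %/ r)%Z.

Lemma place_funP (r : int) : 0 < r ->
  (forall A, ev2 X Y A != 0 -> (r %| ord (ev2 X Y A))%Z) ->
  (exists A B, [/\ ev2 X Y A != 0, ev2 X Y B != 0 & ord (ev2 X Y A) - ord (ev2 X Y B) = r]) ->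
  is_place G (place_fun r).
Proof.
move=> r0 hdiv [A0 [B0 [hA hB hAB]]]; rewrite /place_fun; split.
- by move=> A; rewrite -kerG; case: eqVneq => // h; split=> // e; rewrite e eqxx in h.
- move=> A B; rewrite rmorphM mulf_eq0; case: eqVneq => //= a0.
  case: eqVneq => [|b0] //=; rewrite ordM // divzDl //; exact: hdiv.
- move=> A B; have -> : ev2 X Y (A + B) = ev2 X Y A + ev2 X Y B by exact: rmorphD.
  set a := ev2 X Y A; set b := ev2 X Y B.
  case: (eqVneq (a + b) 0) => [_|ab0]; first by rewrite /vle /=; case: (if _ then _ else _).
  case: (eqVneq a 0) => [a0|a0]; first by rewrite a0 add0r in ab0 *; rewrite (negPf ab0); apply: lexx.
  case: (eqVneq b 0) => [b0|b0]; first by rewrite b0 addr0; apply/orP; left; apply: lexx.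
  have hab : vge (Num.min (ord a) (ord b)) (a + b).
    by apply: vgeD; rewrite vgeE // ge_min lexx ?orbT.
  rewrite vgeE // ge_min in hab; rewrite /=.
  by apply/orP; case/orP: hab => /(lez_pdiv2r (ltW r0)) hh; [left | right].
- by move=> c c0; rewrite ev2_cst fmorph_eq0 (negPf c0) ord_const div0z.
exists A0, B0, (ord (ev2 X Y A0) %/ r)%Z, (ord (ev2 X Y B0) %/ r)%Z.
rewrite (negPf hA) (negPf hB); split=> //.
apply: (mulIf (lt0r_neq0 r0)); rewrite mulrBl mul1r !divzK ?hdiv //.
Qed.

(** The orders of quotients form a subgroup of the integers, nonzero because of [A0]. Its least
    positive element [r] divides every order by Euclidean division, so dividing by [r] normalises
    the valuation. *)
Lemma place_exists A0 : ev2 X Y A0 != 0 -> ord (ev2 X Y A0) != 0 ->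
  exists2 r, 0 < r & is_place G (place_fun r) /\
    (forall A, ev2 X Y A != 0 -> (r %| ord (ev2 X Y A))%Z).
Proof.
move=> a0 o0.
pose V n := exists A B, [/\ ev2 X Y A != 0, ev2 X Y B != 0 &
  ord (ev2 X Y A) - ord (ev2 X Y B) = n].
have one0 : ev2 X Y 1 != 0 by rewrite rmorph1 oner_eq0.
have o1 : ord (ev2 X Y 1) = 0 by rewrite rmorph1 ord_one.
have Vord A : ev2 X Y A != 0 -> V (ord (ev2 X Y A)).
  by move=> h; exists A, 1; rewrite o1 subr0.
have VB a b : V a -> V b -> V (a - b).
  move=> [A [B [hA hB <-]]] [A' [B' [hA' hB' <-]]].
  exists (A * B'), (B * A'); rewrite !rmorphM; split; try exact: mulf_neq0.
  rewrite !ordM //; ring.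
have V0 : V 0 by rewrite -o1; apply: Vord.
have VN a : V a -> V (- a) by move=> h; rewrite -sub0r; apply: VB.
have VD a b : V a -> V b -> V (a + b) by move=> ha hb; rewrite -[b]opprK; apply/VB/VN.
have VM (r : int) (n : nat) : V r -> V (r *+ n).
  by move=> h; elim: n => [|n IH]; rewrite ?mulr0n // mulrS; apply: VD.
have VMz (r k : int) : V r -> V (k * r).
  move=> h; rewrite mulrC; case: k => n; first by rewrite -natz mulr_natr; apply: VM.
  by rewrite NegzE mulrN; apply: VN; rewrite -natz mulr_natr; apply: VM.
have ex : exists n : nat, (0 < n)%N && `[< V n%:Z >].
  exists `|ord (ev2 X Y A0)|%N; rewrite absz_gt0 o0; apply/asboolP.
  by rewrite abszE; case: ger0P => _; [exact: Vord | apply/VN/Vord].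
case: (ex_minnP ex) => r /andP[r0 /asboolP Vr] rmin.
have rz : (0 : int) < r%:Z by [].
have hdiv A : ev2 X Y A != 0 -> (r%:Z %| ord (ev2 X Y A))%Z.
  move=> hA; set o := ord _; apply/dvdz_mod0P.
  have Vs : V (o %% r%:Z)%Z by apply: VB; [exact: Vord | exact: VMz].
  have h0 : 0 <= (o %% r%:Z)%Z by rewrite modz_ge0 // lt0r_neq0.
  have h1 : (o %% r%:Z)%Z < r%:Z by apply: ltz_pmod.
  case: (o %% r%:Z)%Z Vs h0 h1 => // s Vs _ h1.
  case: s Vs h1 => // s Vs; rewrite ltz_nat => h1.
  have : (r <= s.+1)%N by apply: rmin; apply/asboolP.
  by rewrite leqNgt h1.
exists r%:Z => //; split=> //; apply: place_funP => //.
Qed.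

(** The normalising index [r] is only known to exist, so absence from [D] is asked for every [r]. *)
Lemma in_RR_regular D A B A0 : ev2 X Y A0 != 0 -> ord (ev2 X Y A0) != 0 ->
  in_RR G D A B -> ev2 X Y B != 0 ->
  (forall r, 0 < r -> ~ List.In (place_fun r) (map fst D)) ->
  vge 0 (ev2 X Y A / ev2 X Y B).
Proof.
move=> a0 o0 hRR hB hD; have [r r0 [hp hdiv]] := place_exists a0 o0.
have [_ /(_ (hD r r0))] := hRR _ hp.
rewrite /place_fun (negPf hB); case: eqVneq => [-> _|hA /=].
  by rewrite mul0r vge0.
rewrite vgeE ?mulf_neq0 ?invr_eq0 // ordM ?invr_eq0 // ordV // subr_ge0.
by move=> h; rewrite -(divzK (hdiv _ hA)) -(divzK (hdiv _ hB)) ler_pM2r.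
Qed.

Lemma in_RR_simple_pole D A B : is_place G (place_fun 1) ->
  in_RR G D A B -> ev2 X Y B != 0 ->
  List.In (place_fun 1, 1%N) D -> vge (-1) (ev2 X Y A / ev2 X Y B).
Proof.
move=> hp hRR hB hD; have [/(_ _ hD) + _] := hRR _ hp.
rewrite /place_fun (negPf hB) !divz1; case: eqVneq => [-> _|hA /=].
  by rewrite mul0r vge0.
rewrite vgeE ?mulf_neq0 ?invr_eq0 // ordM ?invr_eq0 // ordV //; lia.
Qed.

End Place.
End Orders.

(** * The regular differential *)

Section Fibre.
Variables (C : numClosedFieldType) (L : fieldType) (f : {rmorphism C -> L}).
Local Notation ev1 := (ev1 f).
Local Notation ev2 := (ev2 f).

Definition splits (P Q : {poly C}) (X : L) := exists ys : seq L, uniq ys /\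
  map_poly f Q - (ev1 X P)%:P = f (lead_coef Q) *: \prod_(y <- ys) ('X - y%:P).

Definition fibre (G : {poly {poly C}}) (X : L) (y : 'I_(size G).-1 -> L) :=
  injective y /\ forall k, ev2 X (y k) G = 0.

(** [G] divides [P(x) - Q(y)], which over [X] splits into distinct linear factors; so [G] is the
    product of a selection of them, as many as its degree in [y]. *)
Lemma fibre_exists G P Q X : G \is monic -> dvd2 G (curvePQ P Q) ->
  splits P Q X -> Q != 0 -> exists y, @fibre G X y.
Proof.
move=> monG [H hH] [ys [uys hys]] Q0.
set G' := map_poly (ev1 X) G.
have sG' : size G' = size G.
  by apply: size_map_poly_id0; rewrite (monicP monG) rmorph1 oner_neq0.
have lQ : f (lead_coef Q) != 0 by rewrite fmorph_eq0 lead_coef_eq0.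
have : G' %| \prod_(y <- ys) ('X - y%:P).
  rewrite -(dvdpZr _ _ lQ) -hys -dvdpNr opprB.
  suff -> : (ev1 X P)%:P - map_poly f Q = map_poly (ev1 X) H * G' by apply: dvdp_mull.
  rewrite -rmorphM -hH rmorphB /= map_polyC /= -map_poly_comp; congr (_ - _).
  by apply: eq_map_poly => c /=; rewrite ev1C.
case/dvdp_prod_XsubC => mk; set zs := mask mk ys => hzs.
have szs : size zs = (size G).-1.
  by rewrite -sG' (eqp_size hzs) size_prod_XsubC.
exists (fun k => nth 0 zs k); split.
  move=> i j /eqP; rewrite nth_uniq ?szs ?ltn_ord ?mask_uniq // => /eqP h.
  exact: val_inj.
move=> k; rewrite ev2E -/G'; apply/rootP.
by rewrite (eqp_root hzs) root_prod_XsubC mem_nth // szs.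
Qed.

End Fibre.

Section Roots.
Variable C : numClosedFieldType.
Variables (l : nat) (al : 'I_l -> C) (e : 'I_l -> nat).
Hypothesis al_inj : injective al.
Local Notation F := (\prod_(i < l) ('X - (al i)%:P) ^+ e i).

Lemma mup_prod_exp (a : C) i : a != 0 -> mup (al i) (a *: F) = e i.
Proof.
move=> a0; rewrite -mul_polyC mupMr ?rootC // (bigD1 i) //= mupMl.
  by rewrite mup_XsubCX eqxx.
rewrite /root horner_prod; apply/prodf_neq0 => j ij.
by rewrite horner_exp expf_neq0 // !hornerE subr_eq0; apply: contraNneq ij => /al_inj->.
Qed.

Lemma root_prod_exp (a x : C) : a != 0 -> root (a *: F) x -> exists i, x = al i.
Proof.
move=> a0; rewrite rootZ // /root horner_prod => /prodf_eq0[i _].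
by rewrite horner_exp expf_eq0 !hornerE subr_eq0 => /andP[_ /eqP]; exists i.
Qed.

Lemma size_prod_exp : size F = (\sum_(i < l) e i).+1.
Proof.
elim/big_rec2: _ => [|i s t _ ht]; first by rewrite size_poly1.
rewrite size_monicM ?monic_exp ?monicXsubC //; last by rewrite -size_poly_eq0 ht.
by rewrite size_exp_XsubC ht addnS.
Qed.

End Roots.

Lemma size_deriv_char0 (C : numClosedFieldType) (F : {poly C}) :
  (1 < size F)%N -> size F^`() = (size F).-1.
Proof.
move=> sF; apply/eqP; rewrite eqn_leq; apply/andP; split.
  by rewrite -ltnS (ltn_predK sF) lt_size_deriv // -size_poly_gt0 ltnW.
have e : (size F).-1 = (size F).-2.+1 by case: (size F) sF => [|[]].
rewrite e ltnNge; apply/negP => h.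
have := nth_default 0 h; rewrite coef_deriv -e => /eqP.
by rewrite mulrn_eq0 -lead_coefE lead_coef_eq0 -size_poly_eq0; case: (size F) sF => [|[]].
Qed.

Lemma mulrn_int (x : int) k : x *+ k = x * k%:Z.
Proof. by rewrite -natz mulr_natr. Qed.

(** Here [e], [k] are the orders of [x - c], [y - b] and [r], [s] the multiplicities of [c], [b], so
    that [Q'(y)] has order [k (s - 1)]. For [r = 1] this is [e - k], and for [s = 1] it is zero. *)
Lemma form_arith1 (e k N : int) (r s : nat) : 1 <= e -> 1 <= k -> 0 <= N ->
  (0 < r)%N -> (0 < s)%N -> k * s%:Z = e * r%:Z -> (r <= 1)%N || (s <= 1)%N ->
  1 - e <= N + - (k * s.-1%:Z).
Proof.
move=> e1 k1 N0 r0 s0 h /orP[] h1.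
  have r1 : r = 1%N by lia.
  by rewrite r1 mulr1 in h; have -> : s.-1%:Z = s%:Z - 1 by [lia]; rewrite mulrBr h; lia.
by have -> : s = 1%N by [lia]; rewrite mulr0; lia.
Qed.

(** As [e (r - 1) = k s - e], the first alternative leaves at least [k - e]; the second leaves at
    least zero. *)
Lemma form_arith2 (e k N : int) (r s : nat) : 1 <= e -> 1 <= k ->
  (0 < r)%N -> (0 < s)%N -> k * s%:Z = e * r%:Z ->
  (if (r.-1 <= s.-1)%N then e * r.-1%:Z else k * s.-1%:Z) <= N ->
  1 - e <= N + - (k * s.-1%:Z).
Proof.
move=> e1 k1 r0 s0 h; case: ifP => _; last by lia.
have -> : s.-1%:Z = s%:Z - 1 by lia.
by have -> : r.-1%:Z = r%:Z - 1 by [lia]; rewrite !mulrBr h; lia.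
Qed.

Section Form.
Variables (C : numClosedFieldType) (L : fieldType) (f : {rmorphism C -> L}).
Variable v : valuation f.
Local Notation ord := (ord v).
Local Notation vge := (vge v).
Local Notation ev1 := (ev1 f).
Local Notation ev2 := (ev2 f).
Variables (P Q : {poly C}) (n m l h : nat) (alpha : 'I_l -> C) (p : 'I_l -> nat)
  (beta : 'I_h -> C) (q : 'I_h -> nat).
Hypotheses (sP : size P = n.+1) (sQ : size Q = m.+1) (m2 : (1 < m)%N) (mn : (m <= n)%N).
Hypothesis alpha_inj : injective alpha.
Hypothesis beta_inj : injective beta.
Hypothesis dP : P^`() = (n%:R * lead_coef P) *: \prod_(i < l) ('X - (alpha i)%:P) ^+ p i.
Hypothesis dQ : Q^`() = (m%:R * lead_coef Q) *: \prod_(j < h) ('X - (beta j)%:P) ^+ q j.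
Hypothesis Q_inj : injective (fun j => Q.[beta j]).

Let n1 : (1 < n)%N. Proof. exact: leq_trans mn. Qed.
Let P1 : (1 < size P)%N. Proof. by rewrite sP ltnS ltnW. Qed.
Let Q1 : (1 < size Q)%N. Proof. by rewrite sQ ltnS ltnW. Qed.
Let P0 : P != 0. Proof. by rewrite -size_poly_gt0 ltnW. Qed.
Let Q0 : Q != 0. Proof. by rewrite -size_poly_gt0 ltnW. Qed.
Let aP : n%:R * lead_coef P != 0.
Proof. by rewrite mulf_neq0 ?lead_coef_eq0 -?size_poly_eq0 ?sP // pnatr_eq0; case: n n1. Qed.
Let aQ : m%:R * lead_coef Q != 0.
Proof. by rewrite mulf_neq0 ?lead_coef_eq0 -?size_poly_eq0 ?sQ // pnatr_eq0; case: m m2. Qed.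

Lemma sub_const_neq0 (F : {poly C}) c : (1 < size F)%N -> F - c%:P != 0.
Proof.
by move=> sF; rewrite subr_eq0; apply: contraTneq sF => ->; rewrite size_polyC; case: eqP.
Qed.

Lemma dQ_neq0 : Q^`() != 0.
Proof.
rewrite dQ scaler_eq0 negb_or aQ; apply/prodf_neq0 => j _.
by rewrite expf_neq0 // polyXsubC_eq0.
Qed.

(** Either factor alone would cancel the pole of the form at the pair of critical points. Taking the
    one with the smaller exponent keeps the total degree down to the sum of [minn (p i) (q j)],
    which is what matters at infinity. *)
Definition numer : {poly {poly C}} :=
  \prod_(i < l) \prod_(j < h | P.[alpha i] == Q.[beta j])
    (if (p i <= q j)%N then (Xvar C - cst2 (alpha i)) ^+ p i
     else (Yvar C - cst2 (beta j)) ^+ q j).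
Definition denom : {poly {poly C}} := map_poly polyC Q^`().

Lemma ev2_denom X y : ev2 X y denom = ev1 y Q^`().
Proof. exact: ev2_Y. Qed.

Lemma ord_numer X y : (forall i, X - f (alpha i) != 0) -> (forall j, y - f (beta j) != 0) ->
  ev2 X y numer != 0 /\
  ord (ev2 X y numer) = \sum_(i < l) \sum_(j < h | P.[alpha i] == Q.[beta j])
    (if (p i <= q j)%N then ord (X - f (alpha i)) *+ p i else ord (y - f (beta j)) *+ q j).
Proof.
move=> hX hy; pose F i j := if (p i <= q j)%N then (X - f (alpha i)) ^+ p i else (y - f (beta j)) ^+ q j.
have -> : ev2 X y numer = \prod_(i < l) \prod_(j < h | P.[alpha i] == Q.[beta j]) F i j.
  rewrite /numer rmorph_prod; apply: eq_bigr => i _.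
  rewrite rmorph_prod; apply: eq_bigr => j _; rewrite /F.
  by case: ifP => _; rewrite rmorphXn /= ?ev2_Xsub ?ev2_Ysub.
have F0 i j : F i j != 0 by rewrite /F; case: ifP => _; rewrite expf_neq0.
have F0' i : \prod_(j < h | P.[alpha i] == Q.[beta j]) F i j != 0 by apply/prodf_neq0.
split; first by apply/prodf_neq0.
rewrite ord_prod //; apply: eq_bigr => i _; rewrite ord_prod //.
by apply: eq_bigr => j _; rewrite /F; case: ifP => _; rewrite ordX.
Qed.

(** A pole of [y] would be a pole of [Q(y) = P(X)], which is regular; so [y] has a residue [b]. The
    relation between the orders compares [Q(y) - Q(b)] with the equal [P(X) - P(c)]. *)
Lemma point_fin X c y : X - f c != 0 -> 1 <= ord (X - f c) -> ev1 X P = ev1 y Q ->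
  exists b, [/\ y - f b != 0, 1 <= ord (y - f b), Q.[b] = P.[c] &
   ord (y - f b) *+ mup b (Q - Q.[b]%:P) = ord (X - f c) *+ mup c (P - P.[c]%:P)].
Proof.
move=> X0 hX eXy; have hX1 : vge 1 (X - f c) by rewrite vgeE.
have hX0 : vge 0 X by rewrite -(subrK (f c) X); apply: vgeD (vge_lC _ _); apply: vge_le hX1.
have hy : vge 0 y.
  apply/negPn/negP; rewrite vgePn => /andP[y0 oy].
  have [h0 ho] := ev1_far y0 oy Q0.
  have := vge_horner P hX0; rewrite -ev1E eXy vgeE // ho sQ /= => h1.
  by move: h1; rewrite mulrn_int; nia.
have [b hb] := ord_residue hy.
have hb1 : vge 1 (y - f b) by [].
have ebc : Q.[b] = P.[c].
  have h1 := vge1_horner Q hb1; have h2 := vge1_horner P hX1.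
  rewrite -!ev1E in h1 h2; apply/eqP; rewrite -subr_eq0; apply/eqP.
  apply: (@vge1_lC _ _ _ v); rewrite rmorphB.
  have -> : f Q.[b] - f P.[c] = (ev1 X P - f P.[c]) - (ev1 y Q - f Q.[b]) by rewrite eXy; ring.
  exact: vgeB.
have [hP0 hPo] := ev1_near X0 hX (sub_const_neq0 P.[c] P1).
have e1 : ev1 X (P - P.[c]%:P) = ev1 y (Q - Q.[b]%:P).
  by rewrite !rmorphB /= !ev1C eXy ebc.
have y0 : y - f b != 0.
  apply: contraNneq hP0 => yb; rewrite e1 rmorphB /= ev1C.
  have -> : y = f b by apply/eqP; rewrite -subr_eq0 yb.
  by rewrite ev1E horner_map subrr.
have hyo : 1 <= ord (y - f b) by rewrite -(vgeE _ _ y0).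
exists b; split=> //.
have [_ <-] := ev1_near y0 hyo (sub_const_neq0 Q.[b] Q1).
by rewrite -e1 hPo.
Qed.

Lemma near_neq X c c' : X - f c != 0 -> 1 <= ord (X - f c) -> X - f c' != 0 /\ 0 <= ord (X - f c').
Proof.
move=> X0 hX; have := @ev1_near _ _ _ v X c ('X - c'%:P) X0 hX.
rewrite polyXsubC_eq0 rmorphB /= ev1X ev1C => /(_ isT)[h0 ->]; split=> //.
by rewrite mulrn_wge0 // ltW // (lt_le_trans _ hX).
Qed.

(** This is regularity of eta at finite distance: [dx] has order [ord (X - f c) - 1] and makes up
    for the negative bound. *)
Lemma form_fin X c y : X - f c != 0 -> 1 <= ord (X - f c) -> ev1 X P = ev1 y Q ->
  [/\ ev2 X y numer != 0, ev2 X y denom != 0 &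
      vge (1 - ord (X - f c)) (ev2 X y numer / ev2 X y denom)].
Proof.
move=> X0 hX eXy; have [b [y0 hy ebc ek]] := point_fin X0 hX eXy.
have hXa i := near_neq (alpha i) X0 hX; have hyb j := near_neq (beta j) y0 hy.
have [N0 oN] := ord_numer (fun i => (hXa i).1) (fun j => (hyb j).1).
have [D0 oD] := ev1_near y0 hy dQ_neq0; rewrite mup_deriv // in oD.
rewrite ev2_denom; split=> //.
rewrite vgeE ?mulf_neq0 ?invr_eq0 // ordM ?invr_eq0 // ordV // oD.
set e := ord (X - f c) in hX ek *; set k := ord (y - f b) in hy ek *.
have [_ [_ _ s0]] := mup_sub_root b Q1; have [_ [_ _ r0]] := mup_sub_root c P1.
move: (@mup_deriv _ Q b Q1) (@mup_deriv _ P c P1).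
set s := mup b _ in ek s0 *; set r := mup c _ in ek r0 * => ds dr.
pose T i j := if (p i <= q j)%N then ord (X - f (alpha i)) *+ p i else ord (y - f (beta j)) *+ q j.
have T0 i j : 0 <= T i j.
  by rewrite /T; case: ifP => _; rewrite mulrn_wge0 ?(hXa i).2 ?(hyb j).2.
have hN0 : 0 <= ord (ev2 X y numer) by rewrite oN; apply: sumr_ge0 => i _; apply: sumr_ge0 => j _; apply: T0.
have hk : k * s%:Z = e * r%:Z by move: ek; rewrite !mulrn_int.
rewrite mulrn_int.
have [|h1] := boolP ((1 < r) && (1 < s))%N; last first.
  by apply: (form_arith1 hX hy hN0 r0 s0 hk); move: h1; rewrite negb_and -!leqNgt.
(* Now [c] and [b] are critical points with the same critical value, so [numer] has a factor for
   this pair; the remaining factors have nonnegative order. *)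
case/andP => r1 s1; have [j0 ej] : exists j, b = beta j.
  by apply: (root_prod_exp (e := q) aQ); rewrite -dQ -dvdp_XsubCl XsubC_dvd ?dQ_neq0 // ds -subn1 subn_gt0.
have [i0 ei] : exists i, c = alpha i.
  apply: (root_prod_exp (e := p) aP); rewrite -dP -dvdp_XsubCl XsubC_dvd ?dr; first by rewrite -subn1 subn_gt0.
  rewrite dP scaler_eq0 negb_or aP; apply/prodf_neq0 => j _.
  by rewrite expf_neq0 // polyXsubC_eq0.
have eq0 : q j0 = s.-1 by rewrite -ds ej dQ mup_prod_exp.
have ep0 : p i0 = r.-1 by rewrite -dr ei dP mup_prod_exp.
have hT : T i0 j0 <= ord (ev2 X y numer).
  rewrite oN (bigD1 i0) //= (bigD1 j0) /=; last by rewrite -ei -ej ebc.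
  rewrite -addrA lerDl addr_ge0 //; first by apply: sumr_ge0 => j _; apply: T0.
  by apply: sumr_ge0 => i _; apply: sumr_ge0 => j _; apply: T0.
move: hT; rewrite /T -ei -ej -/e -/k eq0 ep0 !mulrn_int.
exact: (form_arith2 hX hy r0 s0 hk).
Qed.

(** Over a generic point the form has no zero either, so it can be divided out of a residue
    relation. *)
Lemma form_gen X c y : X - f c != 0 -> 1 <= ord (X - f c) -> ev1 X P = ev1 y Q ->
  (forall i, c != alpha i) -> (forall j, P.[c] != Q.[beta j]) ->
  ord (ev2 X y numer / ev2 X y denom) = 0.
Proof.
move=> X0 hX eXy ca cb; have [b [y0 hy ebc _]] := point_fin X0 hX eXy.
have hXa i := near_neq (alpha i) X0 hX; have hyb j := near_neq (beta j) y0 hy.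
have [N0 oN] := ord_numer (fun i => (hXa i).1) (fun j => (hyb j).1).
have [D0 oD] := ev1_near y0 hy dQ_neq0.
have ord0 (Z : L) (d d' : C) : Z - f d != 0 -> 1 <= ord (Z - f d) -> d != d' -> ord (Z - f d') = 0.
  move=> Z0 hZ dd; have := @ev1_near _ _ _ v Z d ('X - d'%:P) Z0 hZ.
  rewrite polyXsubC_eq0 rmorphB /= ev1X ev1C => /(_ isT)[_ ->].
  by rewrite mupNroot // root_XsubC.
have bb j : b != beta j by apply: contraNneq (cb j) => <-; rewrite ebc.
rewrite ordM ?invr_eq0 ?ordV ?ev2_denom // oD oN mupNroot ?mulr0n ?subr0; last first.
  by apply/negP; rewrite dQ => /(root_prod_exp aQ)[j /eqP]; rewrite (negPf (bb j)).
rewrite big1 // => i _; rewrite big1 // => j _.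
by case: ifP => _; [rewrite (ord0 X c _ X0 hX (ca i)) | rewrite (ord0 y b _ y0 hy (bb j))]; rewrite mul0rn.
Qed.

(** As [Q] is injective on its critical points, each [alpha i] is paired with at most one [beta j]:
    either [p i] is the minimum plus the excess over [q j], or it belongs entirely to the last sum.
    The [p i] add up to [n - 1], which leaves at most [(n - 1) - (n - m + 3) = m - 4] for the
    minima. *)
Lemma sum_min_exponents :
  (n - m + 3 <=
     \sum_(i < l) \sum_(j < h | (P.[alpha i] == Q.[beta j]) && (q j < p i)) (p i - q j)
   + \sum_(i < l | [forall j, P.[alpha i] != Q.[beta j]]) p i)%N ->
  (\sum_(i < l) \sum_(j < h | P.[alpha i] == Q.[beta j]) minn (p i) (q j) + 4 <= m)%N.
Proof.
have sump : (\sum_(i < l) p i = n.-1)%N.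
  have : size P^`() = (\sum_(i < l) p i).+1 by rewrite dP size_scale // size_prod_exp.
  by rewrite size_deriv_char0 // sP /= => ->.
have hi i : (p i = \sum_(j < h | P.[alpha i] == Q.[beta j]) minn (p i) (q j) +
    (\sum_(j < h | (P.[alpha i] == Q.[beta j]) && (q j < p i)) (p i - q j) +
     if [forall j, P.[alpha i] != Q.[beta j]] then p i else 0))%N.
  have [j hj|hn] := pickP (fun j => P.[alpha i] == Q.[beta j]).
    have uj j' : (P.[alpha i] == Q.[beta j']) = (j' == j).
      by rewrite (eqP hj); apply/eqP/eqP => [/Q_inj|->].
    have -> : [forall j, P.[alpha i] != Q.[beta j]] = false.
      by apply/negbTE/forallPn; exists j; rewrite negbK.
    rewrite (big_pred1 j uj) addn0; case: (ltnP (q j) (p i)) => hq.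
      rewrite (big_pred1 j); last by move=> j' /=; rewrite uj; case: eqP => // ->; rewrite hq.
      by rewrite subnKC // ltnW.
    rewrite big_pred0 ?addn0 // => j'.
    by rewrite uj; case: eqP => // ->; rewrite ltnNge hq.
  rewrite big_pred0 // big_pred0; last by move=> j; rewrite hn.
  by rewrite ifT //; apply/forallP => j; rewrite hn.
have : (\sum_(i < l) p i)%N = _ := eq_bigr _ (fun i _ => hi i).
rewrite !big_split /= -big_mkcond sump.
set A := (\sum_(i < l) \sum_(j < h | _) minn _ _)%N.
set B := (\sum_(i < l) \sum_(j < h | _) (_ - _))%N.
set D := (\sum_(i < l | _) _)%N.
by move: A B D n1 mn => A B D; clear; lia.
Qed.

(** Here [y] has order [- n], so [denom] has order [- n (m - 1)], and [numer] at least [- n (m - 4)]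
    because [m <= n]. The product has order at least [3 n - m >= 2 m], a double zero in terms of
    [1 / x]. *)
Lemma form_inf X y a' : X != 0 -> ord X = - m%:Z -> ev1 X P = ev1 y Q ->
  (\sum_(i < l) \sum_(j < h | P.[alpha i] == Q.[beta j]) minn (p i) (q j) + 4 <= m)%N ->
  [/\ ev2 X y numer != 0, ev2 X y denom != 0 &
      vge (2 * m%:Z) ((X - f a') * (ev2 X y numer / ev2 X y denom))].
Proof.
move=> X0 oX eXy hsum.
have m0 : (0 < m)%N by apply: ltnW.
have oX0 : ord X < 0 by lia.
have [hP0 hPo] := ev1_far X0 oX0 P0.
rewrite sP /= oX in hPo.
have y0 : y != 0.
  apply/eqP => yz; move: hPo; rewrite eXy yz.
  have -> : ev1 0 Q = f Q.[0] by rewrite ev1E -[X in _.[X]](rmorph0 f) horner_map.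
  by rewrite ord_const mulrn_int => h0; move: h0 m0 n1; clear; nia.
have oy : ord y < 0.
  rewrite ltNge; apply/negP => oy0.
  have hy : vge 0 y by rewrite vgeE.
  have := vge_horner Q hy; rewrite -ev1E -eXy vgeE // hPo mulrn_int.
  by move: m0 n1; clear; nia.
have [hQ0 hQo] := ev1_far y0 oy Q0; rewrite sQ /= -eXy hPo in hQo.
have oyn : ord y = - n%:Z by move: hQo m0; rewrite !mulrn_int; clear; nia.
have hfar Z c : Z != 0 -> ord Z < 0 -> Z - f c != 0 /\ ord (Z - f c) = ord Z.
  move=> Z0 oZ; have := @ev1_far _ _ _ v Z ('X - c%:P) Z0 oZ.
  by rewrite polyXsubC_eq0 rmorphB /= ev1X ev1C size_XsubC => /(_ isT).
have hXa i := hfar X (alpha i) X0 oX0; have hyb j := hfar y (beta j) y0 oy.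
have [N0 oN] := ord_numer (fun i => (hXa i).1) (fun j => (hyb j).1).
have [D0 oD] := ev1_far y0 oy dQ_neq0.
have sdQ : size Q^`() = m by rewrite size_deriv_char0 // sQ.
rewrite sdQ oyn in oD.
have [a0 oa] := hfar X a' X0 oX0.
rewrite ev2_denom; split=> //.
rewrite vgeE ?mulf_neq0 ?invr_eq0 // !ordM ?mulf_neq0 ?invr_eq0 // ordV // oD oa oX.
set E := (\sum_(i < l) \sum_(j < h | _) minn _ _)%N in hsum.
have hN : - (n%:Z * E%:Z)
   <= ord (ev2 X y numer).
  have -> : - (n%:Z * E%:Z) = \sum_(i < l) \sum_(j < h | P.[alpha i] == Q.[beta j])
      (- n%:Z) *+ minn (p i) (q j).
    by under eq_bigr do rewrite sumrMnr; rewrite sumrMnr mulrn_int mulNr.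
  rewrite oN; apply: ler_sum => i _; apply: ler_sum => j _.
  rewrite (hXa i).2 (hyb j).2 oX oyn !mulrn_int; case: leqP => _; last by [].
  by move: mn; clear; nia.
by rewrite mulrn_int; move: hN hsum m0 mn; clear; nia.
Qed.

End Form.

(** * Poles of functions and the Riemann inequality *)

Section Global.
Variables (C : numClosedFieldType) (L : fieldType) (f : {rmorphism C -> L}).
Variable v : valuation f.
Local Notation ord := (ord v).
Local Notation vge := (vge v).
Local Notation ev1 := (ev1 f).
Local Notation ev2 := (ev2 f).
Local Notation t := (unif v).
Implicit Types (P Q : {poly C}) (c : C) (e m : nat).

Definition near_pt c e : L := f c + t ^+ e.
Definition far_pt m : L := t ^- m.

Lemma near_ptP c e : (0 < e)%N -> near_pt c e - f c != 0 /\ ord (near_pt c e - f c) = e%:Z.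
Proof.
move=> e0; rewrite /near_pt [f c + _]addrC addrK expf_neq0 ?unif_neq0 // ordX ?unif_neq0 //.
by rewrite ord_unif mulrn_int mul1r.
Qed.

Lemma far_ptP m : far_pt m != 0 /\ ord (far_pt m) = - m%:Z.
Proof.
rewrite /far_pt invr_eq0 expf_neq0 ?unif_neq0 // ordV ?expf_neq0 ?unif_neq0 //.
by rewrite ordX ?unif_neq0 // ord_unif mulrn_int mul1r.
Qed.

Lemma ev1_near_pt c e P : (0 < e)%N -> P != 0 -> ev1 (near_pt c e) P != 0 /\
  ord (ev1 (near_pt c e) P) = e%:Z * (mup c P)%:Z.
Proof.
move=> e0 P0; have [X0 oX] := near_ptP c e0.
have hX : 1 <= ord (near_pt c e - f c) by rewrite oX; case: e e0 {X0 oX}.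
have [h1 h2] := ev1_near X0 hX P0.
by rewrite h2 oX mulrn_int.
Qed.

Lemma ev1_far_pt m P : (0 < m)%N -> P != 0 -> ev1 (far_pt m) P != 0 /\
  ord (ev1 (far_pt m) P) = - (m%:Z * (size P).-1%:Z).
Proof.
move=> m0 P0; have [X0 oX] := far_ptP m.
have hX : ord (far_pt m) < 0 by rewrite oX oppr_lt0; case: m m0 {X0 oX}.
have [h1 h2] := ev1_far X0 hX P0.
by rewrite h2 oX mulrn_int mulNr.
Qed.

Lemma vge_quot_near i c e P Q : (0 < e)%N -> P != 0 -> Q != 0 ->
  vge i (ev1 (near_pt c e) P / ev1 (near_pt c e) Q) ->
  i <= e%:Z * (mup c P)%:Z - e%:Z * (mup c Q)%:Z.
Proof.
move=> e0 /(ev1_near_pt c e0)[hP oP] /(ev1_near_pt c e0)[hQ oQ].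
by rewrite vgeE ?mulf_neq0 ?invr_eq0 // ordM ?invr_eq0 // ordV // oP oQ.
Qed.

Lemma vge_quot_far i m P Q : (0 < m)%N -> P != 0 -> Q != 0 ->
  vge i (ev1 (far_pt m) P / ev1 (far_pt m) Q) ->
  i <= m%:Z * (size Q).-1%:Z - m%:Z * (size P).-1%:Z.
Proof.
move=> m0 /(ev1_far_pt m0)[hP oP] /(ev1_far_pt m0)[hQ oQ].
by rewrite vgeE ?mulf_neq0 ?invr_eq0 // ordM ?invr_eq0 // ordV // oP oQ opprK addrC.
Qed.

Lemma vge_prod (I : finType) (F : I -> L) : (forall i, vge 0 (F i)) -> vge 0 (\prod_i F i).
Proof.
move=> h; apply: (big_ind (vge 0)) => //; first by rewrite -(rmorph1 f) vge_lC.
by move=> x y hx hy; apply: (vgeM (n := 0) (k := 0)).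
Qed.

(** The uniqueness half of Hensel's lemma: [R(y) - R(y')] is [y - y'] times a factor that reduces to
    [R'(b)], hence a unit. *)
Lemma separated_roots (R : {poly C}) y y' b : vge 1 (y - f b) -> vge 1 (y' - f b) ->
  ev1 y R = ev1 y' R -> R^`().[b] != 0 -> y = y'.
Proof.
move=> hy hy' eR R0.
have hy0 : vge 0 y by rewrite -(subrK (f b) y); apply: vgeD (vge_lC _ _); apply: vge_le hy.
have [r hr er] : exists2 r, ev1 y R - ev1 y' R = (y - y') * r & vge 1 (r - f R^`().[b]).
  elim/poly_ind: R {eR R0} => [|R c [r hr er]].
    by exists 0; rewrite ?rmorph0 ?subrr ?mulr0 // deriv0 horner0 rmorph0 subrr vge0.
  exists (r * y + ev1 y' R).
    rewrite !rmorphD !rmorphM /= !ev1X !ev1C.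
    have -> : ev1 y R = ev1 y' R + (y - y') * r by rewrite -hr addrC subrK.
    by ring.
  rewrite derivD derivM derivX derivC mulr1 addr0 !hornerE rmorphD rmorphM.
  have -> : r * y + ev1 y' R - (f R^`().[b] * f b + f R.[b]) =
    (r - f R^`().[b]) * y + f R^`().[b] * (y - f b) + (ev1 y' R - f R.[b]) by ring.
  apply: vgeD; first apply: vgeD.
  - by rewrite -[1]addr0; apply: vgeM.
  - by rewrite -[1]add0r; apply: vgeM hy; apply: vge_lC.
  - by rewrite ev1E; apply: vge1_horner.
have [r0 _] := ord_unit R0 er.
by move/eqP: hr; rewrite eR subrr eq_sym mulf_eq0 (negPf r0) orbF subr_eq0 => /eqP.
Qed.

Section Component.
Variables (P Q : {poly C}) (n m l h : nat) (alpha : 'I_l -> C) (p : 'I_l -> nat)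
  (beta : 'I_h -> C) (q : 'I_h -> nat).
Hypotheses (sP : size P = n.+1) (sQ : size Q = m.+1) (m2 : (1 < m)%N) (mn : (m <= n)%N).
Hypothesis alpha_inj : injective alpha.
Hypothesis beta_inj : injective beta.
Hypothesis dP : P^`() = (n%:R * lead_coef P) *: \prod_(i < l) ('X - (alpha i)%:P) ^+ p i.
Hypothesis dQ : Q^`() = (m%:R * lead_coef Q) *: \prod_(j < h) ('X - (beta j)%:P) ^+ q j.
Hypothesis Q_inj : injective (fun j => Q.[beta j]).
Hypothesis exponents :
  (\sum_(i < l) \sum_(j < h | P.[alpha i] == Q.[beta j]) minn (p i) (q j) + 4 <= m)%N.
Variable G : {poly {poly C}}.
Hypotheses (irrG : irreducible2 G) (monG : G \is monic) (GPQ : dvd2 G (curvePQ P Q)).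
Local Notation N := (size G).-1.
Local Notation numer := (numer P Q alpha p beta q).
Local Notation denom := (denom Q).
Local Notation fib := (@fibre _ _ f G).

Let m0 : (0 < m)%N. Proof. exact: ltnW. Qed.

Lemma on_curve X y : ev2 X y G = 0 -> ev1 X P = ev1 y Q.
Proof.
move=> hG; apply/eqP; rewrite -subr_eq0 -ev2_curve.
by have [H ->] := GPQ; rewrite rmorphM /= hG mulr0.
Qed.

Lemma near_ker c e y : (0 < e)%N -> ev2 (near_pt c e) y G = 0 ->
  forall A, ev2 (near_pt c e) y A = 0 <-> dvd2 G A.
Proof. by move=> e0 hG; apply: ev2_eq0 => // F /(ev1_near_pt c e0)[]. Qed.

Lemma far_ker y : ev2 (far_pt m) y G = 0 -> forall A, ev2 (far_pt m) y A = 0 <-> dvd2 G A.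
Proof. by move=> hG; apply: ev2_eq0 => // F /(ev1_far_pt m0)[]. Qed.

Section Function.
Variables A B : {poly {poly C}}.
Hypothesis GB : ~ dvd2 G B.

(** One enumeration of the fibre is enough, since norm and trace are symmetric in its points. *)
Definition order_at X i := exists2 y, fib X y & forall k, vge i (ev2 X (y k) A / ev2 X (y k) B).

Let nz_near c e y : (0 < e)%N -> ev2 (near_pt c e) y G = 0 -> ev2 (near_pt c e) y B != 0.
Proof. by move=> e0 hG; apply/eqP => /(near_ker e0 hG). Qed.

Let nz_far y : ev2 (far_pt m) y G = 0 -> ev2 (far_pt m) y B != 0.
Proof. by move=> hG; apply/eqP => /(far_ker hG). Qed.

(* The norm of A / B to C(x) is a rational function without poles, hence a
   constant, and it vanishes at a. *)
Lemma regular_vanishing a y k0 :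
  (forall c, c != a -> exists2 e, (0 < e)%N & order_at (near_pt c e) 0) ->
  order_at (far_pt m) 0 ->
  fib (near_pt a 1) y -> (forall k, vge 0 (ev2 (near_pt a 1) (y k) A / ev2 (near_pt a 1) (y k) B)) ->
  vge 1 (ev2 (near_pt a 1) (y k0) A / ev2 (near_pt a 1) (y k0) B) ->
  dvd2 G A.
Proof.
move=> hfin [yi [yi_inj yi0] hinf] [y_inj y0] ha ha1.
have nB0 : normP G B != 0.
  apply: contraTneq (oner_neq0 L) => hn.
  have := normP_ev monG yi_inj yi0 B; rewrite hn rmorph0 => /esym/eqP.
  by case/prodf_eq0 => k _; rewrite (negPf (nz_far (yi0 k))).
(* If the norm of [A] is zero, [A] vanishes at a generic point and is divisible by [G]. Otherwise
   the two norms turn out to be associate, against the strict inequality of multiplicities at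
   [a]. *)
have [nA0|nA0] := eqVneq (normP G A) 0.
  have := normP_ev monG y_inj y0 A; rewrite nA0 rmorph0 => /esym/eqP.
  by case/prodf_eq0 => k _ /eqP /(near_ker (ltn0Sn 0) (y0 k)).
have quot X (yy : 'I_N -> L) : injective yy -> (forall k, ev2 X (yy k) G = 0) ->
    ev1 X (normP G A) / ev1 X (normP G B) = \prod_k (ev2 X (yy k) A / ev2 X (yy k) B).
  move=> yy_inj yy0; rewrite (normP_ev monG yy_inj yy0) (normP_ev monG yy_inj yy0).
  by rewrite -prodf_div.
have a_strict : (mup a (normP G B) < mup a (normP G A))%N.
  have : vge 1 (ev1 (near_pt a 1) (normP G A) / ev1 (near_pt a 1) (normP G B)).
    rewrite (quot _ _ y_inj y0) (bigD1 k0) //= -[1]addr0; apply: vgeM => //.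
    apply: (big_ind (vge 0)) => //; first by rewrite -(rmorph1 f) vge_lC.
    by move=> x z hx hz; apply: (vgeM (n := 0) (k := 0)).
  by move/(vge_quot_near (ltn0Sn 0) nA0 nB0); rewrite !mul1r; lia.
have hdvd : normP G B %| normP G A.
  apply: (dvdp_mup nB0 nA0) => c; have [->|ca] := eqVneq c a; first exact: ltnW.
  have [e e0 [yc [yc_inj yc0] hc]] := hfin c ca.
  have := vge_prod hc; rewrite -(quot _ _ yc_inj yc0) => /(vge_quot_near e0 nA0 nB0).
  by rewrite subr_ge0 ler_pM2l // ltz_nat.
have hsz : (size (normP G A) <= size (normP G B))%N.
  have := vge_prod hinf; rewrite -(quot _ _ yi_inj yi0) => /(vge_quot_far m0 nA0 nB0).
  rewrite subr_ge0 ler_pM2l ?ltz_nat // lez_nat => hs.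
  by rewrite -[size (normP G A)]prednK ?size_poly_gt0 // -[size (normP G B)]prednK ?size_poly_gt0.
have : normP G B %= normP G A.
  by rewrite -dvdp_size_eqp // eqn_leq hsz dvdp_leq.
rewrite /eqp => /andP[_ hAB].
have : (mup a (normP G A) <= mup a (normP G B))%N.
  by rewrite mup_geq // (dvdp_trans _ hAB) // -mup_geq.
by rewrite leqNgt a_strict.
Qed.

(* The trace to C(x) of A / B (x - a') numer / denom is a rational function with at
   most a simple pole at a and no other pole, vanishing to order two at infinity,
   hence 0.  So the residues of A / B numer / denom dx over a add up to 0. *)
Lemma residue_relation a a' y k0 : a != a' ->
  (forall i, a != alpha i) -> (forall j, P.[a] != Q.[beta j]) ->
  (forall c, c != a -> c != a' -> exists2 e, (0 < e)%N & order_at (near_pt c e) 0) ->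
  order_at (near_pt a' 1) (-1) -> order_at (far_pt m) 0 ->
  fib (near_pt a 1) y ->
  (forall k, vge (-1) (ev2 (near_pt a 1) (y k) A / ev2 (near_pt a 1) (y k) B)) ->
  (forall k, k != k0 -> vge 0 (ev2 (near_pt a 1) (y k) A / ev2 (near_pt a 1) (y k) B)) ->
  vge 0 (ev2 (near_pt a 1) (y k0) A / ev2 (near_pt a 1) (y k0) B).
Proof.
move=> aa' a_alpha a_beta hfin [ya' [ya'_inj ya'0] ha'] [yi [yi_inj yi0] hinf] [y_inj y0] ha ha0.
pose U := A * (Xvar C - cst2 a') * numer; pose D := B * denom.
pose form X Y := (X - f a') * (ev2 X Y numer / ev2 X Y denom).
pose T := traceP G U D; pose d := normP G D.
have ev2_D X (yy : 'I_N -> L) : (forall k, ev2 X (yy k) B != 0) ->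
    (forall k, ev2 X (yy k) denom != 0) -> forall k, ev2 X (yy k) D != 0.
  by move=> hB hD k; rewrite rmorphM /= mulf_neq0.
have d_neq0 X (yy : 'I_N -> L) : injective yy -> (forall k, ev2 X (yy k) G = 0) ->
    (forall k, ev2 X (yy k) D != 0) -> ev1 X d != 0.
  by move=> h1 h2 h3; rewrite (normP_ev monG h1 h2); apply/prodf_neq0.
have trace X (yy : 'I_N -> L) : injective yy -> (forall k, ev2 X (yy k) G = 0) ->
    (forall k, ev2 X (yy k) D != 0) ->
    ev1 X T / ev1 X d = \sum_k ev2 X (yy k) A / ev2 X (yy k) B * form X (yy k).
  move=> h1 h2 h3; rewrite /T (traceP_ev monG h1 h2 U h3) mulrC mulKf ?(d_neq0 _ yy) //.
  apply: eq_bigr => k _; rewrite /U /D !rmorphM /= ev2_Xsub /form invfM.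
  by rewrite -[X in X * (_ * _) = _]mulrA mulrACA -[X in _ * X = _]mulrA.
have near_form c e (yy : 'I_N -> L) : (0 < e)%N -> (forall k, ev2 (near_pt c e) (yy k) G = 0) ->
    (forall k, ev2 (near_pt c e) (yy k) D != 0) /\
    (forall k, vge (1 - e%:Z) (ev2 (near_pt c e) (yy k) numer / ev2 (near_pt c e) (yy k) denom)).
  move=> e0 h2; have [X0 oX] := near_ptP c e0.
  have hX : 1 <= ord (near_pt c e - f c) by rewrite oX; case: e e0 {h2 X0 oX}.
  have hf k := form_fin sP sQ m2 mn alpha_inj beta_inj dP dQ X0 hX (on_curve (h2 k)).
  split=> k; last by have [_ _] := hf k; rewrite oX.
  by apply: ev2_D => j; [apply: nz_near | case: (hf j)].
have far_form k := form_inf sP sQ m2 mn dQ a' (far_ptP m).1 (far_ptP m).2 (on_curve (yi0 k)) exponents.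
have far_D : forall k, ev2 (far_pt m) (yi k) D != 0.
  by apply: ev2_D => j; [apply: nz_far | case: (far_form j)].
have d0 : d != 0.
  by apply: contraNneq (d_neq0 _ _ yi_inj yi0 far_D) => ->; rewrite rmorph0.
have [X0 oX] := near_ptP a (ltn0Sn 0).
have hX : 1 <= ord (near_pt a 1 - f a) by rewrite oX.
have [aform_D aform] := near_form a 1%N y (ltn0Sn 0) y0.
have [Xa'0 oXa'] : near_pt a 1 - f a' != 0 /\ ord (near_pt a 1 - f a') = 0.
  have -> : near_pt a 1 - f a' = near_pt (a - a') 1 by rewrite /near_pt rmorphB /=; ring.
  apply: (@ord_unit _ _ _ v _ (a - a')); rewrite ?subr_eq0 //.
  by have [h1 h2] := near_ptP (a - a') (ltn0Sn 0); rewrite vgeE // h2.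
have sub_vge X : vge 0 X -> vge 0 (X - f a') by move=> hX0; apply: vgeB hX0 (vge_lC _ _).
have near_vge c e : vge 0 (near_pt c e).
  apply: vgeD (vge_lC _ _) _; have t0 : t ^+ e != 0 by rewrite expf_neq0 ?unif_neq0.
  by rewrite vgeE // ordX ?unif_neq0 // ord_unif mulrn_wge0.
have T0 : T = 0.
  apply/eqP/negPn/negP => T0.
  (* The factor ['X - a%:P] absorbs the simple pole at [a]; at [a'] the pole is cancelled by the
     factor [x - a'] of [U]. *)
  have hdvd : d %| ('X - a%:P) * T.
    apply: (dvdp_mup d0); first by rewrite mulf_neq0 // polyXsubC_eq0.
    move=> c; have := mup_XsubCX 1 c a; rewrite expr1 mupM ?polyXsubC_eq0 // => ->.
    have [<-|ca] := eqVneq a c.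
      have : vge (-1) (ev1 (near_pt a 1) T / ev1 (near_pt a 1) d).
        rewrite (trace _ _ y_inj y0 aform_D); apply: vge_sum => k _.
        rewrite -[-1]addr0; apply: vgeM => //; rewrite -[0]addr0; apply: vgeM; last exact: aform.
        exact/sub_vge/near_vge.
      by move/(vge_quot_near (ltn0Sn 0) T0 d0); lia.
    rewrite add0n; have [->|ca'] := eqVneq c a'.
      have [fD fo] := near_form a' 1%N ya' (ltn0Sn 0) ya'0.
      have : vge 0 (ev1 (near_pt a' 1) T / ev1 (near_pt a' 1) d).
        rewrite (trace _ _ ya'_inj ya'0 fD); apply: vge_sum => k _.
        rewrite -[0](addNr 1); apply: vgeM => //; rewrite -[1]addr0; apply: vgeM; last exact: fo.
        by have [h1 h2] := near_ptP a' (ltn0Sn 0); rewrite vgeE // h2.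
      by move/(vge_quot_near (ltn0Sn 0) T0 d0); lia.
    have ca0 : c != a by rewrite eq_sym.
    have [e e0 [yc [yc_inj yc0] hc]] := hfin c ca0 ca'.
    have [fD fo] := near_form c e yc e0 yc0.
    have : vge (1 - e%:Z) (ev1 (near_pt c e) T / ev1 (near_pt c e) d).
      rewrite (trace _ _ yc_inj yc0 fD); apply: vge_sum => k _.
      rewrite -[1 - _]add0r; apply: vgeM => //; rewrite -[1 - _]add0r; apply: vgeM; last exact: fo.
      exact/sub_vge/near_vge.
    (* The order of the trace is a multiple of [e], so the bound [1 - e] already makes it
       nonnegative. *)
    move/(vge_quot_near e0 T0 d0); rewrite -mulrBr; move: (mup c T) (mup c d) e0.
    by clear; nia.
  have hsz : vge (2 * m%:Z) (ev1 (far_pt m) T / ev1 (far_pt m) d).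
    rewrite (trace _ _ yi_inj yi0 far_D); apply: vge_sum => k _.
    by rewrite -[2 * _]add0r; apply: vgeM => //; case: (far_form k).
  (* The order at infinity gives [deg T <= deg d - 2], the divisibility [deg d <= deg T + 1]. *)
  have := vge_quot_far m0 T0 d0 hsz; have := dvdp_leq _ hdvd.
  rewrite mulf_neq0 ?polyXsubC_eq0 // => /(_ isT).
  rewrite mulrC size_Mmonic ?monicXsubC // size_XsubC addn2 /=.
  by move: m0 T0 d0; rewrite -!size_poly_gt0; move: (size T) (size d); clear; nia.
have hsum := trace _ _ y_inj y0 aform_D; rewrite T0 rmorph0 mul0r (bigD1 k0) //= in hsum.
have fo k : ord (ev2 (near_pt a 1) (y k) numer / ev2 (near_pt a 1) (y k) denom) = 0.
  exact: (form_gen p sP sQ m2 mn dQ X0 hX (on_curve (y0 k))).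
have form0 : form (near_pt a 1) (y k0) != 0.
  have [h1 h2 _] := form_fin sP sQ m2 mn alpha_inj beta_inj dP dQ X0 hX (on_curve (y0 k0)).
  by rewrite mulf_neq0 // mulf_neq0 // invr_eq0.
have oform : ord (form (near_pt a 1) (y k0)) = 0.
  rewrite ordM ?oXa' ?fo //; apply: contraNneq form0; rewrite /form => ->; by rewrite mulr0.
(* The vanishing trace is solved for the term at [k0], where the form is a unit; all other terms are
   regular. *)
have -> : ev2 (near_pt a 1) (y k0) A / ev2 (near_pt a 1) (y k0) B =
  - (\sum_(k < N | k != k0) ev2 (near_pt a 1) (y k) A / ev2 (near_pt a 1) (y k) B
      * form (near_pt a 1) (y k)) / form (near_pt a 1) (y k0).
  apply: (mulIf form0); rewrite divfK //; apply/eqP; rewrite -addr_eq0.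
  by rewrite -hsum.
rewrite -[0]addr0; apply: vgeM; last first.
  by rewrite vgeE ?invr_eq0 // ordV // oform.
rewrite vgeN; apply: vge_sum => k kk; rewrite -[0]addr0; apply: vgeM; first exact: ha0.
rewrite -[0]addr0; apply: vgeM; last exact: aform.
exact/sub_vge/near_vge.
Qed.

End Function.
Lemma size_component : (1 < size G)%N.
Proof.
rewrite ltnNge; apply/negP => sG; have := monG.
rewrite (size1_polyC sG) monicE lead_coefC => /eqP hG.
by case: irrG => _ + _; apply; rewrite (size1_polyC sG) hG unitr1.
Qed.

Let P1 : (1 < size P)%N. Proof. by rewrite sP ltnS (leq_trans m0). Qed.
Let Q1 : (1 < size Q)%N. Proof. by rewrite sQ ltnS. Qed.
Let Q0 : Q != 0. Proof. by rewrite -size_poly_gt0 ltnW. Qed.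
Let aQ : m%:R * lead_coef Q != 0.
Proof. by rewrite mulf_neq0 ?lead_coef_eq0 // pnatr_eq0 -lt0n. Qed.

Hypothesis split_near : forall c e, (0 < e)%N ->
  (forall b, Q.[b] = P.[c] -> (mup b (Q - P.[c]%:P) %| e * mup c (P - P.[c]%:P))%N) ->
  splits f P Q (near_pt c e).
Hypothesis split_far : splits f P Q (far_pt m).

Lemma fibre_near c : exists2 e, (0 < e)%N & exists y, fib (near_pt c e) y.
Proof.
(* Every multiplicity of a root of [Q - P(c)] is between 1 and [m], hence divides this factorial. *)
exists m`!; first exact: fact_gt0.
apply: (fibre_exists monG GPQ _ Q0); apply: split_near; first exact: fact_gt0.
move=> b hb; rewrite dvdn_mulr // dvdn_fact // -hb.
have [_ [_ _ ->]] := mup_sub_root b Q1.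
have sF : size (Q - Q.[b]%:P) = m.+1.
  by rewrite size_polyDl sQ // size_polyN size_polyC; case: eqP.
by have := mup_lt_size b (sub_const_neq0 Q.[b] Q1); rewrite sF.
Qed.

Lemma fibre_far : exists y, fib (far_pt m) y.
Proof. exact: (fibre_exists monG GPQ split_far Q0). Qed.

Lemma dQ_neq0_at a b : (forall j, P.[a] != Q.[beta j]) -> Q.[b] = P.[a] -> Q^`().[b] != 0.
Proof.
move=> ha hb; apply/negP => rb; have : root Q^`() b by [].
by rewrite dQ => /(root_prod_exp aQ)[j ej]; move: (ha j); rewrite -hb ej eqxx.
Qed.

Lemma fibre_simple a : (forall j, P.[a] != Q.[beta j]) -> exists y, fib (near_pt a 1) y.
Proof.
move=> ha; apply: (fibre_exists monG GPQ _ Q0); apply: split_near => // b hb.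
have [_ [_ _ s0]] := mup_sub_root b Q1; have := mup_deriv b Q1.
rewrite mupNroot ?(dQ_neq0_at ha) // -hb => hs.
by have -> : mup b (Q - Q.[b]%:P) = 1%N by [move: hs s0; case: (mup _ _) => [|[]]]; rewrite dvd1n.
Qed.

(** The separating function is [y - b], with [b] the residue at the first point: over a generic [a],
    two points with equal residues coincide. It shows that the places of the divisor are
    distinct. *)
Lemma fibre_injective a y y' : (forall j, P.[a] != Q.[beta j]) ->
  ev2 (near_pt a 1) y G = 0 -> ev2 (near_pt a 1) y' G = 0 -> y != y' ->
  exists A, [/\ ev2 (near_pt a 1) y A = 0 \/ 1 <= ord (ev2 (near_pt a 1) y A),
     ev2 (near_pt a 1) y' A != 0 & ord (ev2 (near_pt a 1) y' A) <= 0].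
Proof.
move=> ha hy hy' yy; have [X0 oX] := near_ptP a (ltn0Sn 0).
have hX : 1 <= ord (near_pt a 1 - f a) by rewrite oX.
have [b [yb hb eb _]] := point_fin sP sQ m2 mn X0 hX (on_curve hy).
have e1 z : ev2 (near_pt a 1) z (Yvar C - cst2 b) = z - f b.
  exact: ev2_Ysub.
exists (Yvar C - cst2 b); rewrite !e1; split; first by right.
  apply: contraNneq yy => /eqP; rewrite subr_eq0 => /eqP y'b.
  apply/eqP; apply: (@separated_roots Q y y' b).
  - by rewrite vgeE.
  - by rewrite y'b subrr vge0.
  - by rewrite -(on_curve hy) -(on_curve hy').
  - exact: dQ_neq0_at ha eb.
rewrite leNgt; apply/negP => h1; move/eqP: yy; apply.
apply: (@separated_roots Q y y' b).
- by rewrite vgeE.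
- by apply: ord_vge; rewrite -[1]add0r lezD1.
- by rewrite -(on_curve hy) -(on_curve hy').
- exact: dQ_neq0_at ha eb.
Qed.

Lemma generic_points : exists a : bool -> C,
  [/\ a true != a false, forall s i, a s != alpha i & forall s j, P.[a s] != Q.[beta j]].
Proof.
pose Z := \prod_(i < l) ('X - (alpha i)%:P) * \prod_(j < h) (P - Q.[beta j]%:P).
have Z0 : Z != 0.
  rewrite mulf_neq0 //; apply/prodf_neq0 => i _; rewrite ?polyXsubC_eq0 //.
  exact: sub_const_neq0.
have hZ x : ~~ root Z x -> (forall i, x != alpha i) /\ (forall j, P.[x] != Q.[beta j]).
  rewrite rootM negb_or => /andP[h1 h2]; split=> i.
    apply: contraNneq h1 => ->; rewrite /root horner_prod; apply/prodf_eq0; exists i => //.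
    by rewrite !hornerE subrr.
  apply: contraNneq h2 => hx; rewrite /root horner_prod; apply/prodf_eq0; exists i => //.
  by rewrite !hornerE hx subrr.
have [x hx] := closed_nonrootP _ Z0.
have Z1 : Z * ('X - x%:P) != 0 by rewrite mulf_neq0 // polyXsubC_eq0.
have [x' ] := closed_nonrootP _ Z1; rewrite rootM negb_or root_XsubC => /andP[hx' xx'].
exists (fun s : bool => if s then x' else x); split=> //.
  by case=> i; [have [+ _] := hZ _ hx' | have [+ _] := hZ _ hx].
by case=> i; [have [_] := hZ _ hx' | have [_] := hZ _ hx].
Qed.

Lemma NoDup_map_inj (T : eqType) (U : Type) (F : T -> U) (s : seq T) :
  injective F -> uniq s -> List.NoDup (map F s).
Proof.
move=> F_inj; elim: s => [|x s IH] /=; first by constructor.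
case/andP => xs us; constructor; last exact: IH.
move/List.in_map_iff => [y [/F_inj -> ys]]; case/negP: xs.
by elim: s ys {IH us} => //= z s IH [->|/IH]; rewrite inE ?eqxx // => ->; rewrite orbT.
Qed.

Lemma In_map_mem (T : eqType) (U : Type) (F : T -> U) (s : seq T) x :
  x \in s -> List.In (F x) (map F s).
Proof.
elim: s => //= y s IH; rewrite inE => /orP[/eqP ->|/IH]; first by left.
by right.
Qed.

(** * The divisor of two generic fibres and its Riemann-Roch space *)

Section Divisor.
Variables (a : bool -> C) (y : bool -> 'I_N -> L).
Hypothesis a_neq : a true != a false.
Hypothesis a_alpha : forall s i, a s != alpha i.
Hypothesis a_beta : forall s j, P.[a s] != Q.[beta j].
Hypothesis y_fib : forall s, fib (near_pt (a s) 1) (y s).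

(** The normalising index is 1 because [x - a z.1] has order 1 there. *)
Definition pl (z : bool * 'I_N) := place_fun v (near_pt (a z.1) 1) (y z.1 z.2) 1.

Definition divisor := [seq (pl z, 1%N) | z <- enum {: bool * 'I_N}].

Lemma map_fst_divisor : map fst divisor = map pl (enum {: bool * 'I_N}).
Proof. by rewrite -map_comp. Qed.

Lemma deg_divisor : deg_div divisor = (N + N)%N.
Proof.
rewrite /deg_div -map_comp sumnE big_map.
rewrite (eq_bigr (fun=> 1%N)) // big_const_seq count_predT iter_addn_0 mul1n.
by rewrite -cardE card_prod card_bool card_ord mul2n addnn.
Qed.

Lemma pl_X z : pl z (Xvar C - cst2 (a z.1)) = Some 1.
Proof.
have [X0 oX] := near_ptP (a z.1) (ltn0Sn 0).
by rewrite /pl /place_fun ev2_Xsub (negPf X0) oX divz1.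
Qed.

(** The function [x - a s] has value 1 at the places of the divisor over [a s], and by assumption no
    positive value at the place in question. *)
Lemma not_in_divisor X Y r : 0 < r ->
  (forall s, X - f (a s) != 0 /\ ord (X - f (a s)) <= 0) ->
  ~ List.In (place_fun v X Y r) (map fst divisor).
Proof.
move=> r0 hX; rewrite map_fst_divisor => /List.in_map_iff[z [ez _]].
have := pl_X z; rewrite ez /place_fun ev2_Xsub.
have [/negPf -> oX] := hX z.1; case=> h1; move: oX; apply/negP; rewrite -ltNge.
apply: (lt_le_trans r0); rewrite -[r]mul1r -h1 lez_floor // lt0r_neq0 //.
Qed.

Lemma near_other c e s : (0 < e)%N -> c != a s ->
  near_pt c e - f (a s) != 0 /\ ord (near_pt c e - f (a s)) = 0.
Proof.
move=> e0 cs; have -> : near_pt c e - f (a s) = near_pt (c - a s) e.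
  by rewrite /near_pt rmorphB /=; ring.
apply: (@ord_unit _ _ _ v _ (c - a s)); rewrite ?subr_eq0 //.
have [h1 h2] := near_ptP (c - a s) e0; rewrite vgeE // h2.
by case: e e0 {h1 h2}.
Qed.

Lemma pl_inj : injective pl.
Proof.
move=> [s k] [s' k'] ez; have [X0 oX] := near_ptP (a s) (ltn0Sn 0).
have ss : s = s'.
  apply/eqP/negPn/negP => ss; have := pl_X (s, k); rewrite ez.
  have as' : a s' != a s by move: ss a_neq; case: (s); case: (s') => //= _ hs; rewrite eq_sym.
  have [/negPf h1 h2] := near_other (ltn0Sn 0) as'.
  by rewrite /pl /place_fun ev2_Xsub h1 h2 div0z.
subst s'; congr (_, _); have [yi y0] := y_fib s; apply: yi; apply/eqP/negPn/negP => yk.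
have [A [hA hA0 oA]] := fibre_injective (a_beta s) (y0 k) (y0 k') yk.
have := congr1 (fun F => F A) ez; rewrite /pl /place_fun /= (negPf hA0) !divz1.
case: eqP => // hA1 [eo]; case: hA => // h1.
by move: oA; rewrite -eo leNgt (lt_le_trans _ h1).
Qed.

Lemma pl_place z : is_place G (pl z).
Proof.
have [yi y0] := y_fib z.1.
apply: (place_funP (near_ker (ltn0Sn 0) (y0 z.2))) => //.
have [X0 oX] := near_ptP (a z.1) (ltn0Sn 0).
exists (Xvar C - cst2 (a z.1)), 1; rewrite rmorph1 oner_neq0 ord_one subr0.
by rewrite ev2_Xsub.
Qed.

Lemma eff_divisor_divisor : eff_divisor G divisor.
Proof.
split; last by rewrite map_fst_divisor; apply: (NoDup_map_inj pl_inj); apply: enum_uniq.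
by move=> w k /List.in_map_iff[z [[<- _] _]]; apply: pl_place.
Qed.

Section Pencil.
Variables (B : {poly {poly C}}) (A : 'I_(N + N) -> {poly {poly C}}).
Hypothesis GB : ~ dvd2 G B.
Hypothesis RR : forall i, in_RR G divisor (A i) B.

Lemma regular_near i c e Y : (0 < e)%N -> (forall s, c != a s) ->
  ev2 (near_pt c e) Y G = 0 -> vge 0 (ev2 (near_pt c e) Y (A i) / ev2 (near_pt c e) Y B).
Proof.
move=> e0 ca hG; have [X0 oX] := near_ptP c e0.
have eX : ev2 (near_pt c e) Y (Xvar C - cst2 c) = near_pt c e - f c.
  by rewrite ev2_Xsub.
apply: (@in_RR_regular _ _ _ v G _ _ (near_ker e0 hG) divisor _ _ (Xvar C - cst2 c)).
- by rewrite eX.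
- by rewrite eX oX; case: e e0 {X0 oX eX hG}.
- exact: RR.
- by apply/eqP => /(near_ker e0 hG).
move=> r r0; apply: (not_in_divisor r0) => s.
by have [h1 ->] := near_other e0 (ca s).
Qed.

Lemma regular_far i Y : ev2 (far_pt m) Y G = 0 ->
  vge 0 (ev2 (far_pt m) Y (A i) / ev2 (far_pt m) Y B).
Proof.
move=> hG; have [X0 oX] := far_ptP m.
have eX := ev2_Xvar f (far_pt m) Y.
apply: (@in_RR_regular _ _ _ v G _ _ (far_ker hG) divisor _ _ (Xvar C)).
- by rewrite eX.
- by rewrite eX oX oppr_eq0; case: (m) m0.
- exact: RR.
- by apply/eqP => /(far_ker hG).
move=> r r0; apply: (not_in_divisor r0) => s.
have hX : ord (far_pt m) < 0 by rewrite oX oppr_lt0 ltz_nat.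
have := ev1_far X0 hX (_ : 'X - (a s)%:P != 0).
rewrite polyXsubC_eq0 rmorphB /= ev1X ev1C size_XsubC => /(_ isT)[h1 ->].
by rewrite ltW.
Qed.

Definition quot i s k := ev2 (near_pt (a s) 1) (y s k) (A i) / ev2 (near_pt (a s) 1) (y s k) B.

Lemma quot_pole i s k : vge (-1) (quot i s k).
Proof.
have [yi y0] := y_fib s; have hG := y0 k.
apply: (in_RR_simple_pole (pl_place (s, k)) (RR i)).
  by apply/eqP => /(near_ker (ltn0Sn 0) hG).
by apply: (In_map_mem (fun z => (pl z, 1%N)) (x := (s, k))); rewrite mem_enum.
Qed.

Lemma t_vge : vge 1 t. Proof. by rewrite vgeE ?unif_neq0 // ord_unif. Qed.
Lemma tV_vge : vge (-1) t^-1.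
Proof. by rewrite vgeE ?invr_eq0 ?unif_neq0 // ordV ?unif_neq0 // ord_unif. Qed.

Lemma polar_part x : vge (-1) x -> exists c d, vge 1 (x - f c / t - f d).
Proof.
move=> hx; have [c hc] : exists c, vge 1 (x * t - f c).
  by have := vgeM hx t_vge; rewrite addNr; apply: ord_residue.
have hc0 : vge 0 (x - f c / t).
  have -> : x - f c / t = (x * t - f c) * t^-1 by rewrite mulrBl mulfK ?unif_neq0.
  by have := vgeM hc tV_vge; rewrite addrN.
by have [d hd] := ord_residue hc0; exists c, d.
Qed.

Lemma pencil_dependent : exists2 c : 'I_(N + N) -> C, (exists i, c i != 0) &
  dvd2 G (\sum_i cst2 (c i) * A i).
Proof.
have N0 : (0 < N)%N by rewrite -subn1 subn_gt0 size_component.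
pose k0 : 'I_N := Ordinal N0.
have /choice[cd hcd] (z : 'I_(N + N) * bool * 'I_N) :
    exists cd : C * C, vge 1 (quot z.1.1 z.1.2 z.2 - f cd.1 / t - f cd.2).
  by have [c [d hcd]] := polar_part (quot_pole z.1.1 z.1.2 z.2); exists (c, d).
(* The conditions: no polar part outside k0 over both points, and no constant term at k0
   over the first; the polar parts at k0 are then controlled by residue_relation.  There
   is one condition less than unknowns, so a column of M is free to be zero. *)
pose M : 'M[C]_(N + N) := \matrix_(i, j) match split j with
  | inl k => if k == k0 then (cd (i, true, k)).2 else (cd (i, true, k)).1
  | inr k => if k == k0 then 0 else (cd (i, false, k)).1 end.
have : \det M == 0.
  rewrite (expand_det_col _ (rshift N k0)) big1 // => i _.
  by rewrite mxE -[rshift N k0]/(unsplit (inr k0)) unsplitK eqxx mul0r.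
case/det0P => w w0 hw; pose c i := w 0 i.
have col j : \sum_i c i * M i j = 0.
  by have := congr1 (fun V : 'rV_(N + N) => V 0 j) hw; rewrite !mxE.
have c_neq0 : exists i, c i != 0.
  apply/existsP; apply: contraNT w0; rewrite negb_exists => /forallP hc.
  by apply/eqP/rowP => i; rewrite mxE; apply/eqP/negPn.
exists c => //; set F := \sum_i _.
have ev2F X Y : ev2 X Y F / ev2 X Y B = \sum_i f (c i) * (ev2 X Y (A i) / ev2 X Y B).
  rewrite rmorph_sum mulr_suml; apply: eq_bigr => i _.
  by rewrite rmorphM /= ev2_cst mulrA.
have vge_comb i0 (g : 'I_(N + N) -> L) : (forall i, vge i0 (g i)) ->
    vge i0 (\sum_i f (c i) * g i).
  by move=> hg; apply: vge_sum => i _; rewrite -[i0]add0r; apply: vgeM (vge_lC _ _) _.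
have reg_near c' : (forall s, c' != a s) ->
    exists2 e, (0 < e)%N & order_at F B (near_pt c' e) 0.
  move=> ca; have [e e0 [Y [Yi Y0]]] := fibre_near c'; exists e => //; exists Y => // k.
  by rewrite ev2F; apply: vge_comb => i; apply: regular_near.
have reg_far : order_at F B (far_pt m) 0.
  have [Y [Yi Y0]] := fibre_far; exists Y => // k.
  by rewrite ev2F; apply: vge_comb => i; apply: regular_far.
have pole s k : vge (-1) (ev2 (near_pt (a s) 1) (y s k) F / ev2 (near_pt (a s) 1) (y s k) B).
  by rewrite ev2F; apply: vge_comb => i; apply: quot_pole.
have expand s k : ev2 (near_pt (a s) 1) (y s k) F / ev2 (near_pt (a s) 1) (y s k) B =
    \sum_i f (c i) * (quot i s k - f (cd (i, s, k)).1 / t - f (cd (i, s, k)).2) +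
    f (\sum_i c i * (cd (i, s, k)).1) / t + f (\sum_i c i * (cd (i, s, k)).2).
  rewrite ev2F !rmorph_sum mulr_suml -!big_split /=; apply: eq_bigr => i _.
  by rewrite !rmorphM /= -/(quot i s k); ring.
have hcd1 i s k : vge 1 (quot i s k - f (cd (i, s, k)).1 / t - f (cd (i, s, k)).2).
  exact: (hcd (i, s, k)).
have reg_point s k : k != k0 ->
    vge 0 (ev2 (near_pt (a s) 1) (y s k) F / ev2 (near_pt (a s) 1) (y s k) B).
  move=> kk; rewrite expand.
  have -> : \sum_i c i * (cd (i, s, k)).1 = 0.
    case: s {pole expand hcd1}; [have := col (lshift N k) | have := col (rshift N k)] => hs.
      rewrite -[RHS]hs; apply: eq_bigr => i _.
      by rewrite mxE -[lshift N k]/(unsplit (inl k)) unsplitK (negPf kk).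
    rewrite -[RHS]hs; apply: eq_bigr => i _.
    by rewrite mxE -[rshift N k]/(unsplit (inr k)) unsplitK (negPf kk).
  rewrite rmorph0 mul0r addr0; apply: vgeD (vge_lC _ _).
  by apply: vge_comb => i; apply: vge_le (hcd1 i s k).
(* The residue relation is used once over each point, the other point [a (~~ s)] playing the role of
   [a']. *)
have reg_k0 s : vge 0 (ev2 (near_pt (a s) 1) (y s k0) F / ev2 (near_pt (a s) 1) (y s k0) B).
  apply: (@residue_relation F B GB (a s) (a (~~ s)) (y s) k0) => //.
  - by move: a_neq; case: (s) => //= hs; rewrite eq_sym.
  - move=> c' h1 h2; apply: reg_near => s'.
    by have [->|/negPf ss] := eqVneq s' s => //; have -> : s' = ~~ s by [move: ss; case: s'; case: (s)].
  - by exists (y (~~ s)).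
  - by move=> k kk; apply: reg_point.
have reg s k : vge 0 (ev2 (near_pt (a s) 1) (y s k) F / ev2 (near_pt (a s) 1) (y s k) B).
  by have [->|kk] := eqVneq k k0; [apply: reg_k0 | apply: reg_point].
apply: (@regular_vanishing F B GB (a true) (y true) k0) => //.
- move=> c' ca; have [->|cf] := eqVneq c' (a false); last first.
    by apply: reg_near => -[].
  by exists 1%N => //; exists (y false).
have := reg_k0 true; rewrite expand.
have -> : \sum_i c i * (cd (i, true, k0)).2 = 0.
  have := col (lshift N k0) => hs; rewrite -[RHS]hs; apply: eq_bigr => i _.
  by rewrite mxE -[lshift N k0]/(unsplit (inl k0)) unsplitK eqxx.
(* Since [S] is O(t), regularity forces the polar coefficient [g] to be zero. The constant term is
   zero by the choice of [c], so the function vanishes at [k0]. *)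
rewrite rmorph0 addr0; set S := \sum_i f (c i) * _; set g := \sum_i c i * _ => hS.
have S1 : vge 1 S by apply: vge_comb => i; apply: hcd1.
have hg : vge 1 (f g).
  have -> : f g = ((S + f g / t) - S) * t by rewrite [S + _]addrC addrK divfK ?unif_neq0.
  rewrite -[1]add0r; apply: vgeM t_vge; apply: vgeB hS _; exact: vge_le S1.
by rewrite (vge1_lC hg) rmorph0 mul0r addr0.
Qed.

End Pencil.

Lemma divisor_ell : ~ ell_ge G divisor (N + N).
Proof.
move=> [B [A [GB RR indep]]]; have [c [i ci] hc] := pencil_dependent GB RR.
by move: ci; rewrite (indep c hc) eqxx.
Qed.

End Divisor.

(** The refuted statement is Riemann's inequality for genus 1; the one for genus 0 asks for one
    dimension more and implies it by [ell_geS]. *)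
Lemma genus_gt1 : ~ (forall D, eff_divisor G D -> ell_ge G D (deg_div D)).
Proof.
move=> genus; have [a [a_neq a_alpha a_beta]] := generic_points.
have /choice[y y_fib] s : exists ys, fib (near_pt (a s) 1) ys by apply: fibre_simple.
apply: (@divisor_ell a y) => //.
by rewrite -(deg_divisor a y); apply: genus; apply: eff_divisor_divisor.
Qed.

End Component.
End Global.

(** * Scaling a component to a monic one, and the conclusion *)

Section Transfer.
Variable C : fieldType.
Implicit Types (G H : {poly {poly C}}).

Lemma ell_geS G D k : ell_ge G D k.+1 -> ell_ge G D k.
Proof.
move=> [B [A [GB RR indep]]]; exists B, (fun i => A (lift ord0 i)); split=> // c hc i.
pose c' j := if unlift ord0 j is Some i then c i else 0.
have -> : c i = c' (lift ord0 i) by rewrite /c' liftK.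
apply: indep; rewrite big_ord_recl {1}/c' unlift_none /cst2 !polyC0 mul0r add0r.
by under eq_bigr do rewrite /c' liftK.
Qed.

(** Places and Riemann-Roch spaces depend on [G] only through divisibility by it, so [G] may be
    scaled by a constant. *)
Lemma is_place_dvd2 G H : dvd2 G = dvd2 H -> is_place G = is_place H.
Proof. by move=> e; apply: funext => w; rewrite /is_place e. Qed.

Lemma eff_divisor_dvd2 G H : dvd2 G = dvd2 H -> eff_divisor G = eff_divisor H.
Proof. by move=> e; apply: funext => D; rewrite /eff_divisor (is_place_dvd2 e). Qed.

Lemma ell_ge_dvd2 G H : dvd2 G = dvd2 H -> ell_ge G = ell_ge H.
Proof.
move=> e; apply: funext => D; apply: funext => k.
by rewrite /ell_ge /in_RR (is_place_dvd2 e) e.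
Qed.

Lemma unit_cst2 (k : C) : k != 0 -> cst2 k \is a GRing.unit.
Proof.
by move=> k0; rewrite poly_unitE size_polyC polyC_eq0 k0 coefC /= poly_unitE size_polyC k0 coefC /= unitfE.
Qed.

Lemma dvd2_scale G k : k != 0 -> dvd2 (cst2 k * G) = dvd2 G.
Proof.
move=> k0; have kK : cst2 k^-1 * cst2 k = 1 by rewrite /cst2 -!polyCM mulVf.
apply: funext => A; apply: propext; split=> -[H ->].
  by exists (H * cst2 k); rewrite mulrA.
by exists (H * cst2 k^-1); rewrite -mulrA [cst2 _ * (_ * _)]mulrA kK mul1r.
Qed.

Lemma irreducible2_scale G k : k != 0 -> irreducible2 G -> irreducible2 (cst2 k * G).
Proof.
move=> k0 [G0 nG hG]; have uk := unit_cst2 k0; have ukV : cst2 k^-1 \is a GRing.unit.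
  by rewrite unit_cst2 // invr_eq0.
have kK : cst2 k^-1 * cst2 k = 1 by rewrite /cst2 -!polyCM mulVf.
split; first by rewrite mulf_neq0 // /cst2 !polyC_eq0.
  by rewrite unitrM => /andP[].
move=> A B e; have : G = (cst2 k^-1 * A) * B by rewrite -mulrA -e mulrA kK mul1r.
by case/hG; [rewrite unitrM => /andP[_]; left | right].
Qed.

(** As a polynomial in [y], [P(x) - Q(y)] has the nonzero constant [- lead_coef Q] as leading
    coefficient. The leading coefficient of a divisor divides it and is therefore a nonzero constant
    too. *)
Lemma monic_component (P Q : {poly C}) G : (1 < size Q)%N -> dvd2 G (curvePQ P Q) ->
  exists2 k, k != 0 & cst2 k * G \is monic.
Proof.
move=> sQ [H eH]; have lQ : lead_coef Q != 0 by rewrite lead_coef_eq0 -size_poly_gt0 ltnW.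
have : lead_coef (curvePQ P Q) = - (lead_coef Q)%:P.
  rewrite /curvePQ addrC lead_coefDl; last first.
    rewrite size_polyN size_map_polyC size_polyC (leq_ltn_trans _ sQ) //.
    by case: eqP.
  by rewrite lead_coefN lead_coef_map_inj //; apply: polyC_inj.
rewrite eH lead_coefM => e.
have : lead_coef G \is a GRing.unit.
  have : lead_coef H * lead_coef G \is a GRing.unit.
    by rewrite e unitrN poly_unitE size_polyC lQ coefC unitfE.
  by rewrite unitrM => /andP[].
rewrite poly_unitE => /andP[/size_poly1P[c c0 hc] _].
exists c^-1; first by rewrite invr_eq0.
by rewrite monicE lead_coefM /cst2 lead_coefC hc -polyCM mulVf.
Qed.

End Transfer.

Theorem theorem1p2 (R : realType) (P Q : {poly R[i]})
  (l h : nat) (alpha : 'I_l -> R[i]) (p : 'I_l -> nat)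
  (beta : 'I_h -> R[i]) (q : 'I_h -> nat) :
  let n := (size P).-1 in
  let m := (size Q).-1 in
  (2 <= m)%N -> (m <= n)%N ->
  (* P'(X) = n a_n prod (X - alpha_i)^p_i, alpha_i distinct, p_i >= 1 *)
  injective alpha -> (forall i, 0 < p i)%N ->
  P^`() = (n%:R * lead_coef P) *: \prod_(i < l) ('X - (alpha i)%:P) ^+ p i ->
  (* Q'(X) = m b_m prod (X - beta_j)^q_j, beta_j distinct, q_j >= 1 *)
  injective beta -> (forall j, 0 < q j)%N ->
  Q^`() = (m%:R * lead_coef Q) *: \prod_(j < h) ('X - (beta j)%:P) ^+ q j ->
  (* Hypothesis I for P and for Q *)
  injective (fun i => P.[alpha i]) ->
  injective (fun j => Q.[beta j]) ->
  (* P(x) - Q(y) has no factor of degree one *)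
  (forall G, dvd2 G (curvePQ P Q) -> ~ degree_one G) ->
  (n - m + 3 <=
     \sum_(i < l) \sum_(j < h | (P.[alpha i] == Q.[beta j]) && (q j < p i)) (p i - q j)
   + \sum_(i < l | [forall j, P.[alpha i] != Q.[beta j]]) p i)%N ->
  forall G, irreducible2 G -> dvd2 G (curvePQ P Q) ->
    ~ (geom_genus G 0 \/ geom_genus G 1).
Proof.
move=> n m m2 mn alpha_inj _ dP beta_inj _ dQ _ Q_inj _ hsum G irrG GPQ hgenus.
have sQ : size Q = m.+1 by rewrite prednK //; have := m2; rewrite /m; case: (size Q).
have sP : size P = n.+1.
  by rewrite prednK //; have := leq_trans m2 mn; rewrite /n; case: (size P).
have m0 : (0 < m)%N by apply: ltnW.
have exponents := sum_min_exponents sP m2 mn dP Q_inj hsum.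
have sQ1 : (1 < size Q)%N by rewrite sQ.
have sP1 : (1 < size P)%N by rewrite sP ltnS (leq_trans m0).
have [k k0 monG] := monic_component sQ1 GPQ.
have GG := dvd2_scale G k0.
pose v := laurent_valuation [the fieldType of R[i]].
apply: (genus_gt1 (v := v) sP sQ m2 mn alpha_inj beta_inj dP dQ exponents
  (irreducible2_scale k0 irrG) monG).
- by rewrite GG.
- by move=> c e e0 hdiv; apply: split_fin.
- by apply: (split_inf sP sQ) => //; apply: leq_trans mn.
move=> D; rewrite (eff_divisor_dvd2 GG) (ell_ge_dvd2 GG) => hD.
case: hgenus => -[+ _] => /(_ D hD); last by rewrite addnK.
by rewrite subn0 addn1; apply: ell_geS.
Qed.
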